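(* Let $\{p_i\}_{i\ge 1}$ be a bounded sequence of integers $p_i\ge 2$ and let $\{w_n\}_{n\in\mathbb{Z}_+}$ be the corresponding Vilenkin system on $[0,1]$. For every $1<p\le 2$ there is a constant $C$, depending only on $p$ and the sequence $\{p_i\}$, such that the following holds. Let $\{I_s\}$ be any family of pairwise disjoint finite intervals (segments) in $\mathbb{Z}_+$ and let $\{f_s\}$ be functions on $[0,1]$ with $\operatorname{supp}\widehat{f}_s\subset I_s$ for every $s$ (so each $f_s$ is a Vilenkin polynomial). Then $$ \Big\| \sum_s f_s \Big\|_{L^p[0,1]}\le C\, \Big\|\Big(\sum_s |f_s|^2\Big)^{1/2}\Big\|_{L^p[0,1]}. $$
   Context: $\mathbb{Z}_+$ is the set of non-negative integers. An interval (segment) in $\mathbb{Z}_+$ is a finite set of consecutive integers $[a,b)\cap\mathbb{Z}_+$ with $a<b$ in $\mathbb{Z}_+$. Vilenkin system. Put $m_0=1$ and $m_l=p_1p_2\cdots p_l$. For $k\ge 1$, the generalized Rademacher function $r_k$ is defined on $[0,1)$ by $r_k(x)=\exp\big(2\pi i\lfloor m_k x\rfloor/p_k\big)$; that is, each of the $m_{k-1}$ equal segments of $[0,1)$ of length $1/m_{k-1}$ is divided into $p_k$ equal parts and $r_k$ equals $e^{2\pi i j/p_k}$ on the $j$th part, $0\le j\le p_k-1$. (The value at the point $1$ is irrelevant.) Every $n\in\mathbb{Z}_+$ has a unique representation $n=\alpha_1+\alpha_2m_1+\dots+\alpha_k m_{k-1}$ with $0\le\alpha_i\le p_i-1$ (up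 to leading zeros), and $w_n=r_1^{\alpha_1}r_2^{\alpha_2}\cdots r_k^{\alpha_k}$. The functions $w_n$ form an orthonormal basis of $L^2[0,1]$. The Vilenkin–Fourier coefficients of $f$ are $\widehat f(n)=\int_0^1 f\,\overline{w_n}$. If the family is infinite, the inequality is asserted whenever the right-hand side is finite, with $\sum_s f_s$ understood as the limit in $L^p$ of its finite partial sums. *)

(* Defs.v *)
(* Written in MathComp-Analysis; complex values live in R[i] of
   mathcomp-real-closed over a realType R. *)
From HB Require Import structures.
From mathcomp Require Import all_boot all_order all_algebra.
From mathcomp Require Import finmap.
From mathcomp Require Import all_classical all_reals all_analysis.
From mathcomp Require Import complex.
From mathcomp Require summability.
Import Order.TTheory GRing.Theory Num.Theory.
Import numFieldNormedType.Exports.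
Import ComplexField.Normc.

Set Implicit Arguments.
Unset Strict Implicit.
Unset Printing Implicit Defensive.

Local Open Scope classical_set_scope.
Local Open Scope ring_scope.

(* The base sequence is 1-based: ps 1, ps 2, ...; the value ps 0 is never
   used.  In particular vil_m ps 0 = 1. *)
Definition vil_m (ps : nat -> nat) (l : nat) : nat :=
  (\prod_(1 <= i < l.+1) ps i)%N.

(* Used for k >= 1. *)
Definition vil_digit (ps : nat -> nat) (k n : nat) : nat :=
  ((n %/ vil_m ps k.-1) %% ps k)%N.

Definition cexpi {R : realType} (t : R) : R[i] := (cos t +i* sin t)%C.

Definition vil_rademacher {R : realType} (ps : nat -> nat) (k : nat) (x : R) :
    R[i] :=
  cexpi (2 * pi * (Num.floor ((vil_m ps k)%:R * x))%:~R / (ps k)%:R).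

(* All digits of n of index k > n vanish, since vil_m ps k.-1 >= 2 ^ k.-1;
   see vil_digitP and vil_digit_uniq below. *)
Definition vil_w {R : realType} (ps : nat -> nat) (n : nat) (x : R) : R[i] :=
  \prod_(1 <= k < n.+1) vil_rademacher ps k x ^+ vil_digit ps k n.

Definition unit_itv (R : realType) : set R := `[0, 1]%classic.
Arguments unit_itv R : clear implicits.

Definition cmeasurable01 {R : realType} (f : R -> R[i]) : Prop :=
  measurable_fun (unit_itv R) (fun x => complex.Re (f x)) /\
  measurable_fun (unit_itv R) (fun x => complex.Im (f x)).

Definition cintegrable01 {R : realType} (f : R -> R[i]) : Prop :=
  lebesgue_measure.-integrable (unit_itv R)
    (fun x => (complex.Re (f x))%:E) /\
  lebesgue_measure.-integrable (unit_itv R)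
    (fun x => (complex.Im (f x))%:E).

Definition cintegral01 {R : realType} (f : R -> R[i]) : R[i] :=
  ((\int[lebesgue_measure]_(x in unit_itv R) complex.Re (f x))%R +i*
   (\int[lebesgue_measure]_(x in unit_itv R) complex.Im (f x))%R)%C.

Definition vil_coef {R : realType} (ps : nat -> nat) (f : R -> R[i]) (n : nat) :
    R[i] :=
  cintegral01 (fun x => f x * ((vil_w ps n x)^*)%C).

Definition Lp01 {R : realType} (p : R) (g : R -> \bar R) : \bar R :=
  ('N[lebesgue_measure]_p%:E[g \_ (unit_itv R)])%E.

(* normc is the R-valued modulus (the norm of R[i] is R[i]-valued). *)
Definition cLp01 {R : realType} (p : R) (f : R -> R[i]) : \bar R :=
  Lp01 p (fun x => (normc (f x))%:E).

Definition square_fun {R : realType} {S : choiceType} (f : S -> R -> R[i])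
    (x : R) : \bar R :=
  ((\esum_(s in [set: S]) (normc (f s x) ^+ 2)%:E) `^ 2^-1)%E.

(* Convergence along the directed set of finite subsets of S, so that no
   enumeration of the family is chosen. *)
Definition Lp_sum {R : realType} {S : choiceType} (p : R) (f : S -> R -> R[i])
    (F : R -> R[i]) : Prop :=
  [/\ cmeasurable01 F,
      (cLp01 p F < +oo)%E &
      (fun A : {fset S} => cLp01 p (fun x => F x - \sum_(s <- A) f s x))
        @ @summability.totally S --> 0%E].

Definition is_segment (J : set nat) : Prop :=
  exists a b : nat, (a < b)%N /\ J = [set n | (a <= n < b)%N].

Lemma vil_mS (ps : nat -> nat) l : vil_m ps l.+1 = (vil_m ps l * ps l.+1)%N.
Proof. by rewrite /vil_m big_nat_recr. Qed.

Lemma vil_m_exp (ps : nat -> nat) l :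
  (forall i, (0 < i)%N -> (2 <= ps i)%N) -> (2 ^ l <= vil_m ps l)%N.
Proof.
move=> ps2; elim: l => [|l IH]; first by rewrite /vil_m big_geq.
by rewrite vil_mS expnSr leq_mul// ps2.
Qed.

Lemma vil_digit_lt (ps : nat -> nat) k n :
  (forall i, (0 < i)%N -> (2 <= ps i)%N) -> (0 < k)%N ->
  (vil_digit ps k n < ps k)%N.
Proof. by move=> ps2 k0; rewrite ltn_mod (leq_trans _ (ps2 _ k0)). Qed.

Lemma vil_digitP (ps : nat -> nat) n :
  (forall i, (0 < i)%N -> (2 <= ps i)%N) ->
  n = (\sum_(1 <= k < n.+1) vil_digit ps k n * vil_m ps k.-1)%N.
Proof.
move=> ps2.
have H l : (n = \sum_(1 <= k < l.+1) vil_digit ps k n * vil_m ps k.-1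
               + n %/ vil_m ps l * vil_m ps l)%N.
  elim: l => [|l IH]; first by rewrite big_geq// /vil_m big_geq// divn1 muln1.
  rewrite big_nat_recr//= {1}IH -addnA; congr addn.
  rewrite /vil_digit /= vil_mS divnMA.
  by rewrite {1}(divn_eq (n %/ vil_m ps l) (ps l.+1)) mulnDl addnC -mulnA
    (mulnC (vil_m ps l)).
rewrite [LHS](H n) divn_small ?mul0n ?addn0//.
by rewrite (leq_trans (ltn_expl n (ltnSn 1)))// vil_m_exp.
Qed.

Lemma vil_m_gt0 (ps : nat -> nat) l :
  (forall i, (0 < i)%N -> (2 <= ps i)%N) -> (0 < vil_m ps l)%N.
Proof.
by move=> ps2; rewrite (leq_trans _ (vil_m_exp l ps2))// expn_gt0.
Qed.

Lemma vil_sum_lt (ps al : nat -> nat) l :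
  (forall i, (0 < i <= l)%N -> (al i < ps i)%N) ->
  (\sum_(1 <= k < l.+1) al k * vil_m ps k.-1 < vil_m ps l)%N.
Proof.
elim: l => [|l IH] al_lt; first by rewrite big_geq// /vil_m big_geq.
rewrite big_nat_recr//= vil_mS (mulnC (vil_m ps l)).
have /IH h i : (0 < i <= l)%N -> (al i < ps i)%N.
  by move=> /andP[i0 il]; rewrite al_lt// i0 leqW.
have a_lt : (al l.+1 < ps l.+1)%N by rewrite al_lt// leqnn.
apply: (@leq_trans (vil_m ps l + al l.+1 * vil_m ps l)%N).
  by rewrite ltn_add2r.
by rewrite -mulSn leq_mul2r a_lt orbT.
Qed.

Lemma vil_m_dvd (ps : nat -> nat) j l :
  (j <= l)%N -> (vil_m ps j %| vil_m ps l)%N.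
Proof.
move=> /subnKC <-; elim: (l - j)%N => [|d IH]; first by rewrite addn0.
by rewrite addnS vil_mS dvdn_mulr.
Qed.

Lemma vil_digit_uniq (ps : nat -> nat) (al : nat -> nat) n l :
  (forall i, (0 < i)%N -> (2 <= ps i)%N) ->
  (forall i, (0 < i <= l)%N -> (al i < ps i)%N) ->
  n = (\sum_(1 <= k < l.+1) al k * vil_m ps k.-1)%N ->
  forall k, (0 < k)%N -> vil_digit ps k n = if (k <= l)%N then al k else 0%N.
Proof.
move=> ps2; elim: l n => [|l IH] n al_lt.
  rewrite big_geq// => -> k k0.
  by rewrite leqNgt k0 /= /vil_digit div0n mod0n.
rewrite big_nat_recr//=; set N := (X in (X + _)%N) => nE k k0.
have al_lt' i : (0 < i <= l)%N -> (al i < ps i)%N.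
  by case/andP=> i0 il; rewrite al_lt// i0 leqW.
have IHN := IH N al_lt' erefl.
have N_lt : (N < vil_m ps l)%N by exact: vil_sum_lt.
have n_lt : (n < vil_m ps l.+1)%N.
  by rewrite nE; have := vil_sum_lt al_lt; rewrite big_nat_recr.
case: (ltngtP k l.+1) => kl.
- have /dvdnP[q qE] : (vil_m ps k %| vil_m ps l)%N by exact: vil_m_dvd.
  rewrite -(prednK k0) vil_mS (prednK k0) (mulnC (vil_m _ _)) in qE.
  have := IHN k k0; rewrite -ltnS kl => <-.
  rewrite /vil_digit nE qE !mulnA addnC divnMDl ?vil_m_gt0//.
  by rewrite modnMDl.
- rewrite /vil_digit divn_small ?mod0n//.
  rewrite (leq_trans n_lt)// dvdn_leq ?vil_m_gt0// vil_m_dvd//.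
  by rewrite -ltnS prednK.
- rewrite kl /vil_digit /= nE addnC divnMDl ?vil_m_gt0// divn_small// addn0.
  by rewrite modn_small// al_lt// leqnn.
Qed.

(* Main.v *)
Require Import Defs.
From HB Require Import structures.
From mathcomp Require Import all_boot all_order all_algebra.
From mathcomp Require Import finmap.
From mathcomp Require Import all_classical all_reals all_analysis.
From mathcomp Require Import measurable_realfun complex ring lra.
Import Order.TTheory GRing.Theory Num.Theory.
Import numFieldNormedType.Exports.
Import ComplexField.Normc.
Set Implicit Arguments.
Unset Strict Implicit.
Unset Printing Implicit Defensive.
Local Open Scope classical_set_scope.
Local Open Scope ring_scope.

(** The inequality is dual to the boundedness on [L^q], [q = p / (p - 1) >= 2],
  of the square function of the spectral projections onto disjoint intervals,
  and for the dual inequality everything rests on a local orthogonality.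

  The key fact about the characters is Paley's lemma ([dirichlet_kernel]): a
  block [c * m_k <= n < c.+1 * m_k] of frequencies has a projection with kernel
  supported where both variables lie in the same cell of length [1 / m_k].
  So the projection onto a union of such blocks acts separately on each cell,
  and a family of projections onto disjoint unions of blocks satisfies
  Bessel's inequality on every single cell.

  An interval is cut into two halves ([interval_split]), each with a base
  point [b], an outer endpoint, such that for every [k] the part of the half
  outside the block of length [m_k] around [b] is a union of blocks of that
  length.  Multiplying the projection of [h] by the conjugate of [w_b] turns it
  into a martingale for the filtration of the cells whose value at time [k]
  collects exactly the frequencies in the block around [b].  What remains after
  time [k] therefore has, over all intervals and on each cell, no more energy
  than [h] ([modproj_tail]).  The martingale takes values in a Euclidean space
  with two coordinates for each interval.

  A martingale whose remaining energy is controlled in this way is bounded in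
  [L^q] for [q >= 2] ([local_energy_bound]).  Expanding the [q]-th power of its
  norm to second order bounds the integral by a sum of squared increments
  with weights [U_k `^ (q - 2)], where [U] is the running maximum of the
  conditional expectations of the norm.  The splitting of cells into boundedly
  many cells makes these weights predictable.  Summation by parts replaces the
  increments of the martingale with those of the weights, times remaining
  energies, and leads to the integral of [U `^ (q - 2)] times the square of
  [h].  Young's inequality and Doob's maximal inequality absorb the power of
  [U].  This gives [grid_square_function], and duality gives
  [grid_interval_inequality], for functions on a finite grid.

  An integrable function with finitely many frequencies agrees almost
  everywhere with a Vilenkin polynomial ([spectral_expansion], by Lebesgue
  differentiation along cells), that is, with a step function on a fine grid,
  which gives finite families ([finite_family_integral]).  For an infinite
  family the inequality applied to finite subfamilies bounds the differences of
  partial sums by tails of the square function, which tend to zero in [L^p] by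
  dominated convergence; the sum exists by completeness of [L^p]
  ([Lp_cauchy_limit]), and Fatou's lemma passes the bounds to the limit. *)

(** * Inequalities for real powers *)

Section power_inequalities.
Context {R : realType}.
Implicit Types a b d r s t W : R.

Lemma powR_le r a b : 0 <= r -> 0 <= a -> a <= b -> a `^ r <= b `^ r.
Proof.
by move=> r0 a0 ab; rewrite ge0_ler_powR// nnegrE ?(le_trans a0 ab).
Qed.

Lemma powR_sq r a : 0 <= a -> (a ^+ 2) `^ (r / 2) = a `^ r.
Proof.
by move=> a0; rewrite -powR_mulrn// -powRrM mulrCA mulfV ?mulr1// pnatr_eq0.
Qed.

Lemma powR_exprn r a n : 0 <= a -> (a ^+ n) `^ r = (a `^ r) ^+ n.
Proof.
by move=> a0; rewrite -(powR_mulrn n a0) -(powR_mulrn n (powR_ge0 a r)) powRAC.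
Qed.

Lemma powR_split2 r a : 2 <= r -> 0 <= a -> a `^ r = a ^+ 2 * a `^ (r - 2).
Proof.
move=> r2 a0; have [->|a1] := eqVneq a 0.
  by rewrite expr0n /= mul0r powR0 ?gt_eqF//; lra.
rewrite -powR_mulrn// -powRD; first by congr powR; ring.
by apply/implyP.
Qed.

Lemma powR_split1 r a : 1 <= r -> 0 <= a -> a `^ r = a * a `^ (r - 1).
Proof. by move=> r1 a0; rewrite mulr_powRB1//; lra. Qed.

(** Young's inequality in absorbing form: either [b] is at most [d * a `^ t] and
  the first term dominates, or [a] is at most a power of [b / d] and the second
  does. *)
Lemma powR_young s t d a b : 0 <= s -> 0 < t -> 0 < d -> 0 <= a -> 0 <= b ->
  a `^ s * b <= d * a `^ (s + t) + d `^ (- (s / t)) * b `^ ((s + t) / t).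
Proof.
move=> s0 t0 d0 a0 b0; have st0 : s + t != 0 by rewrite gt_eqF// ltr_wpDl.
have [bd|db] := leP b (d * a `^ t).
  apply: (@le_trans _ _ (d * a `^ (s + t))); last first.
    by rewrite lerDl mulr_ge0// powR_ge0.
  rewrite powRD ?(negbTE st0)// mulrCA ler_wpM2l ?powR_ge0//.
apply: (@le_trans _ _ (d `^ (- (s / t)) * b `^ ((s + t) / t))); last first.
  by rewrite lerDr mulr_ge0 ?powR_ge0// ltW.
have b1 : 0 < b by rewrite (le_lt_trans _ db)// mulr_ge0 ?powR_ge0// ltW.
have -> : (s + t) / t = s / t + 1 by rewrite mulrDl mulfV// gt_eqF.
rewrite powRD; last by rewrite (gt_eqF b1) implybT.
rewrite powRr1// mulrA ler_wpM2r// powRN -ler_pdivrMl ?invr_gt0 ?powR_gt0//.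
rewrite invrK.
have -> : a `^ s = (a `^ t) `^ (s / t).
  by rewrite -powRrM mulrCA mulfV ?mulr1// gt_eqF.
rewrite -powRM ?powR_ge0 ?(ltW d0)// powR_le ?divr_ge0 ?(ltW t0)//.
  by rewrite mulr_ge0 ?powR_ge0// ltW.
exact: ltW.
Qed.

(** Convexity of the power function, multiplied out to include [b = 0]. *)
Lemma powR_tangent r a b : 1 <= r -> 0 <= a -> 0 <= b ->
  r * a * b `^ (r - 1) <= a `^ r + (r - 1) * b `^ r.
Proof.
move=> r1 a0 b0; have [->|nr1] := eqVneq r 1.
  by rewrite subrr mul0r addr0 powRr1// powRr0 mul1r mulr1.
have r1' : 1 < r by rewrite lt_neqAle eq_sym nr1.
have r0 : 0 < r by lra.
have r10 : 0 < r - 1 by lra.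
have := @conjugate_powR R a (b `^ (r - 1)) r (r / (r - 1)) a0 (powR_ge0 _ _) r0.
rewrite divr_gt0// => /(_ isT) H.
have {}H := H _; move: H; rewrite -powRrM mulrCA mulfV ?gt_eqF// mulr1 => H.
have {}H : a * b `^ (r - 1) <= a `^ r / r + b `^ r / (r / (r - 1)).
  by apply: H; field; rewrite !gt_eqF.
rewrite -mulrA -ler_pdivlMl// (le_trans H)// mulrDr [_ * a `^ r]mulrC lerD2l.
by rewrite le_eqVlt; apply/orP; left; apply/eqP; field; rewrite !gt_eqF.
Qed.

(** The form of the mean value theorem that turns a running maximum into an
  integral against its own increments. *)
Lemma powR_doob_step r a b : 2 <= r -> 0 <= a -> a <= b ->
  b `^ r - a `^ r <= 2 * b * (b `^ (r - 1) - a `^ (r - 1)).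
Proof.
move=> r2 a0 ab; have b0 := le_trans a0 ab.
have r1 : 1 <= r by lra.
have r1' : 1 <= r - 1 by lra.
rewrite !(powR_split1 r1)// !(powR_split1 r1')//.
have P : a `^ (r - 1 - 1) <= b `^ (r - 1 - 1) by rewrite powR_le//; lra.
have := powR_ge0 a (r - 1 - 1); move: P.
set A := a `^ _; set B := b `^ _ => AB A0.
rewrite -subr_ge0.
have -> : 2 * b * (b * B - a * A) - (b * (b * B) - a * (a * A)) =
  (B - A) * b ^+ 2 + A * (b - a) ^+ 2 by ring.
by rewrite addr_ge0// mulr_ge0 ?sqr_ge0 ?subr_ge0.
Qed.

(** A bound of [b `^ s - a `^ s] by the derivative at [b], up to a constant; the
  factor [b] makes it uniform in exponents below and above [1]. *)
Lemma powR_increment s a b : 0 <= s -> 0 <= a -> a <= b ->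
  b * (b `^ s - a `^ s) <= (1 + s) * b `^ s * (b - a).
Proof.
move=> s0 a0 ab; have b0 := le_trans a0 ab.
have Bs := powR_ge0 b s.
have ba : 0 <= b - a by rewrite subr_ge0.
have [s1|s1] := leP 1 s.
  have := powR_tangent s1 a0 b0.
  move/(ler_wpM2l b0) => H.
  have E : b * (s * a * b `^ (s - 1)) = s * a * b `^ s.
    by rewrite mulrCA (powR_split1 s1 b0).
  rewrite E in H.
  have := mulr_ge0 Bs ba; nra.
have H : a * b `^ s <= b * a `^ s.
  have [->|an0] := eqVneq a 0; first by rewrite mul0r mulr_ge0 ?powR_ge0.
  have bn0 : b != 0.
    by rewrite gt_eqF// (lt_le_trans _ ab)// lt_neqAle eq_sym an0.
  have E x : x != 0 -> 0 <= x -> x = x `^ s * x `^ (1 - s).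
    move=> xn0 x0; rewrite -powRD; last by rewrite xn0 implybT.
    by rewrite addrC subrK powRr1.
  rewrite [in leLHS](E a)// [b in leRHS](E b)//.
  have : a `^ (1 - s) <= b `^ (1 - s) by rewrite powR_le//; lra.
  move=> /(ler_wpM2r (mulr_ge0 (powR_ge0 a s) (powR_ge0 b s))) H.
  by nra.
have := mulr_ge0 (mulr_ge0 s0 Bs) ba; nra.
Qed.

(** A second order Taylor bound for the power function in the variable
  [a ^+ 2]; the first order term has the exact derivative, so that it can be
  cancelled against a martingale increment. *)
Lemma powR_ito_step r a b W : 2 <= r -> 0 <= a -> 0 <= b -> a <= W -> b <= W ->
  b `^ r - a `^ r <= (r / 2) * a `^ (r - 2) * (b ^+ 2 - a ^+ 2)
     + r * (r - 1) * W `^ (r - 2) * (b - a) ^+ 2.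
Proof.
move=> r2 a0 b0 aW bW; set s := r - 2.
have s0 : 0 <= s by rewrite /s; lra.
have W0 := le_trans a0 aW.
have r21 : 1 <= r / 2 by lra.
have T : r / 2 * a ^+ 2 * b `^ s <= a `^ r + (r / 2 - 1) * b `^ r.
  have := powR_tangent r21 (sqr_ge0 a) (sqr_ge0 b).
  rewrite !powR_sq//; have -> : r / 2 - 1 = s / 2 by rewrite /s; field.
  by rewrite powR_sq.
have C : (b `^ s - a `^ s) * (b ^+ 2 - a ^+ 2) <=
         2 * (r - 1) * W `^ s * (b - a) ^+ 2.
  have K x y : 0 <= x -> x <= y -> y <= W ->
      (y `^ s - x `^ s) * (y ^+ 2 - x ^+ 2) <=
         2 * (r - 1) * W `^ s * (y - x) ^+ 2.
    move=> x0 xy yW; have y0 := le_trans x0 xy.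
    have H1 := powR_increment s0 x0 xy.
    have H2 : y `^ s <= W `^ s by rewrite powR_le.
    have yx : 0 <= y - x by rewrite subr_ge0.
    have xys : 0 <= y `^ s - x `^ s by rewrite subr_ge0 powR_le.
    have H3 : (y `^ s - x `^ s) * (y + x) <= 2 * (y * (y `^ s - x `^ s)) by nra.
    have H4 : (1 + s) * y `^ s * (y - x) <= (r - 1) * W `^ s * (y - x).
      rewrite (_ : 1 + s = r - 1); last by rewrite /s; ring.
      by rewrite ler_wpM2r// ler_wpM2l//; lra.
    have -> : (y `^ s - x `^ s) * (y ^+ 2 - x ^+ 2) =
       ((y `^ s - x `^ s) * (y + x)) * (y - x) by ring.
    have -> : 2 * (r - 1) * W `^ s * (y - x) ^+ 2 =
       (2 * ((r - 1) * W `^ s * (y - x))) * (y - x) by ring.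
    by rewrite ler_wpM2r//; lra.
  have [ab|ba] := leP a b; first exact: K.
  have := K b a b0 (ltW ba) aW.
  by rewrite -(sqrrN (a - b)) opprB; nra.
rewrite [b `^ r](powR_split2 r2)// in T *.
have H := ler_wpM2l (_ : 0 <= r / 2) C.
have {}H := H (ltac:(lra)).
have E : r / 2 * (2 * (r - 1) * W `^ s * (b - a) ^+ 2) =
   r * (r - 1) * W `^ s * (b - a) ^+ 2 by field.
rewrite E in H; lra.
Qed.

End power_inequalities.

(** * Martingales on a finite space *)

Lemma sum_sqr_ge0 (R : realDomainType) (I : finType) (u : I -> R) :
  0 <= \sum_i u i ^+ 2.
Proof. by apply: sumr_ge0 => i _; exact: sqr_ge0. Qed.

Lemma cauchy_schwarz_sum (R : rcfType) (I : finType) (u v : I -> R) :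
  \sum_i u i * v i <=
  Num.sqrt (\sum_i u i ^+ 2) * Num.sqrt (\sum_i v i ^+ 2).
Proof.
rewrite -sqrtrM ?sum_sqr_ge0//.
apply: le_trans (ler_norm _) _; rewrite -sqrtr_sqr ler_sqrt; last first.
  by rewrite mulr_ge0 ?sum_sqr_ge0.
have H : 0 <= \sum_i \sum_j (u i * v j - u j * v i) ^+ 2.
  by apply: sumr_ge0 => i _; exact: sum_sqr_ge0.
have E : \sum_i \sum_j (u i * v j - u j * v i) ^+ 2 =
  2 * ((\sum_i u i ^+ 2) * (\sum_i v i ^+ 2) - (\sum_i u i * v i) ^+ 2).
  have E1 : (\sum_i u i ^+ 2) * (\sum_i v i ^+ 2) =
            \sum_i \sum_j u i ^+ 2 * v j ^+ 2.
    by rewrite mulr_suml; apply: eq_bigr => i _; rewrite mulr_sumr.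
  have E2 : (\sum_i u i ^+ 2) * (\sum_i v i ^+ 2) =
            \sum_i \sum_j u j ^+ 2 * v i ^+ 2.
    by rewrite E1 exchange_big.
  have E3 : (\sum_i u i * v i) ^+ 2 = \sum_i \sum_j (u i * v i) * (u j * v j).
    by rewrite expr2 mulr_suml; apply: eq_bigr => i _; rewrite mulr_sumr.
  rewrite mulrBr mulrDl mul1r {1}E1 E2 E3 mulr_sumr -!big_split -sumrB /=.
  apply: eq_bigr => i _; rewrite mulr_sumr -!big_split -sumrB /=.
  by apply: eq_bigr => j _; ring.
by move: H; rewrite E pmulr_rge0 ?subr_ge0.
Qed.

Section filtration.
Context {R : realType} {T : finType} (a : nat -> T -> nat) (N : nat).

Definition adapted k (g : T -> R) := forall x y, a k x = a k y -> g x = g y.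

(** The conditional expectation on the partition of [T] into the level sets of
  [a k], for the uniform measure. *)
Definition cexp k (f : T -> R) x :=
  (\sum_(y | a k y == a k x) f y) / #|[pred y | a k y == a k x]|%:R.

Hypothesis filt : forall k x y, (k < N)%N -> a k.+1 x = a k.+1 y -> a k x = a k y.

Lemma card_atom_gt0 k x : 0 < #|[pred y | a k y == a k x]|%:R :> R.
Proof. by rewrite ltr0n; apply/card_gt0P; exists x; rewrite inE. Qed.

Lemma cexp_adapted k f : adapted k (cexp k f).
Proof. by move=> x y axy; rewrite /cexp axy. Qed.

Lemma adaptedW j k g : (j <= k)%N -> (k <= N)%N -> adapted j g -> adapted k g.
Proof.
move=> jk kN gj x y axy; apply: gj; elim: k jk kN axy => [|k IH].
  by rewrite leqn0 => /eqP ->.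
rewrite leq_eqVlt => /predU1P[-> //|]; rewrite ltnS => jk kN /(filt kN).
exact: (IH jk (ltnW kN)).
Qed.

Lemma sum_cexp k g f : adapted k g ->
  \sum_x g x * cexp k f x = \sum_x g x * f x.
Proof.
move=> gk; rewrite /cexp.
under eq_bigr => x _ do rewrite mulr_suml mulr_sumr big_mkcond /=.
rewrite exchange_big /=; apply: eq_bigr => y _.
rewrite -big_mkcond /=.
rewrite (eq_bigr (fun=> g y * (f y / #|[pred z | a k z == a k y]|%:R))).
  rewrite sumr_const (@eq_card _ _ [pred z | a k z == a k y]); last first.
    by move=> z; rewrite !inE eq_sym.
  by rewrite -(mulr_natr (g y * _)) -mulrA divfK// gt_eqF// card_atom_gt0.
by move=> x /eqP axy; rewrite -(gk _ _ axy) axy.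
Qed.

Lemma cexp_ge0 k f x : (forall y, 0 <= f y) -> 0 <= cexp k f x.
Proof. by move=> f0; rewrite divr_ge0// sumr_ge0. Qed.

Lemma cexp_const k g f x : adapted k g ->
  cexp k (fun y => g y * f y) x = g x * cexp k f x.
Proof.
move=> gk; rewrite /cexp mulrA; congr (_ / _); rewrite mulr_sumr.
by apply: eq_bigr => y /eqP /gk ->.
Qed.

Lemma cexp_id f x : injective (a N) -> cexp N f x = f x.
Proof.
move=> inj; rewrite /cexp.
have E y : (a N y == a N x) = (y == x) by rewrite inj_eq.
rewrite (eq_bigl _ _ E) big_pred1_eq (@eq_card _ _ (pred1 x)); last first.
  by move=> y; rewrite !inE E.
by rewrite card1 divr1.
Qed.

Lemma le_cexp k f g x : (forall y, f y <= g y) -> cexp k f x <= cexp k g x.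
Proof. by move=> fg; rewrite ler_pM2r ?invr_gt0 ?card_atom_gt0// ler_sum. Qed.

(** Comparison in the mean over each atom suffices against adapted weights. *)
Lemma sum_adapted_le k g f h : (forall x, 0 <= g x) -> adapted k g ->
  (forall x, \sum_(y | a k y == a k x) f y <= \sum_(y | a k y == a k x) h y) ->
  \sum_x g x * f x <= \sum_x g x * h x.
Proof.
move=> g0 gk fh; rewrite -(sum_cexp f gk) -(sum_cexp h gk).
apply: ler_sum => x _; rewrite ler_wpM2l// ler_pM2r//.
by rewrite invr_gt0 card_atom_gt0.
Qed.

Section maximal_function.
Variable Y : T -> R.
Hypothesis Y0 : forall x, 0 <= Y x.

(** Doob's maximal function, stopped at time [k]. *)
Fixpoint cexp_max k x :=
  if k is k'.+1 then Num.max (cexp_max k' x) (cexp k Y x) else cexp 0 Y x.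

Lemma cexp_max_ge0 k x : 0 <= cexp_max k x.
Proof.
by elim: k => [|k IH] /=; rewrite ?cexp_ge0// le_max IH.
Qed.

Lemma cexp_max_leS k x : cexp_max k x <= cexp_max k.+1 x.
Proof. by rewrite /= le_max lexx. Qed.

Lemma cexp_le_cexp_max k x : cexp k Y x <= cexp_max k x.
Proof. by case: k => //= k; rewrite le_max lexx orbT. Qed.

Lemma cexp_max_adapted k : (k <= N)%N -> adapted k (cexp_max k).
Proof.
elim: k => [|k IH] kN /=; first exact: cexp_adapted.
move=> x y axy; rewrite (cexp_adapted Y axy).
by rewrite (IH (ltnW kN) x y)//; exact: filt axy.
Qed.

(** When the running maximum increases it equals the current conditional
  expectation, and the increment of its power is an adapted weight, so that
  the conditional expectation can be replaced with [Y]. *)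
Lemma doob_weighted r k : 2 <= r -> (k <= N)%N ->
  \sum_x cexp_max k x `^ r <= 2 * \sum_x cexp_max k x `^ (r - 1) * Y x.
Proof.
move=> r2; have r1 : 1 <= r by lra.
elim: k => [|k IH] kN.
  rewrite -(@sum_cexp 0); last by move=> x y axy; rewrite (cexp_max_adapted _ axy).
  rewrite -[leLHS]mul1r ler_pM ?ler1n//.
    by apply: sumr_ge0 => x _; exact: powR_ge0.
  apply: ler_sum => x _ /=; rewrite (powR_split1 r1) ?cexp_ge0//.
  by rewrite mulrC.
pose D x := cexp_max k.+1 x `^ (r - 1) - cexp_max k x `^ (r - 1).
have Dk : adapted k.+1 D.
  move=> x y axy; rewrite /D (cexp_max_adapted kN axy).
  by rewrite (cexp_max_adapted (ltnW kN) (filt kN axy)).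
have E : \sum_x cexp_max k.+1 x `^ (r - 1) * Y x =
   \sum_x cexp_max k x `^ (r - 1) * Y x + \sum_x D x * cexp k.+1 Y x.
  rewrite (sum_cexp _ Dk) -big_split /=; apply: eq_bigr => x _.
  by rewrite /D; ring.
rewrite E mulrDr; apply: le_trans (lerD (IH (ltnW kN)) (lexx _)).
rewrite mulr_sumr -big_split /=; apply: ler_sum => x _.
rewrite -lerBlDl; apply: (le_trans (powR_doob_step r2 (cexp_max_ge0 _ _) (cexp_max_leS _ _))).
rewrite le_eqVlt; apply/orP; left; apply/eqP.
rewrite -/(cexp_max k.+1 x) -/(D x).
have [le|lt] := leP (cexp k.+1 Y x) (cexp_max k x).
  by rewrite /D /= max_l// subrr !(mulr0, mul0r).
have -> : cexp_max k.+1 x = cexp k.+1 Y x by rewrite /= max_r// ltW.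
ring.
Qed.

Lemma doob r : 2 <= r ->
  \sum_x cexp_max N x `^ r <= 4 * 4^-1 `^ (1 - r) * \sum_x Y x `^ r.
Proof.
move=> r2; have H := doob_weighted r2 (leqnn N).
have H2 : \sum_x cexp_max N x `^ (r - 1) * Y x <=
   4^-1 * (\sum_x cexp_max N x `^ r) + 4^-1 `^ (1 - r) * \sum_x Y x `^ r.
  rewrite !mulr_sumr -big_split /=; apply: ler_sum => x _.
  have := @powR_young _ (r - 1) 1 4^-1 (cexp_max N x) (Y x).
  rewrite !divr1 subrK opprB; apply => //; [lra|exact: cexp_max_ge0].
lra.
Qed.

End maximal_function.

Section vector_martingale.
Context {I : finType} (M : I -> T -> R).

(** The Euclidean norm of the martingale closed by [M], at time [k]. *)
Definition step_norm k x := Num.sqrt (\sum_i cexp k (M i) x ^+ 2).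

Lemma step_norm_ge0 k x : 0 <= step_norm k x. Proof. exact: sqrtr_ge0. Qed.

Lemma step_norm_sq k x : step_norm k x ^+ 2 = \sum_i cexp k (M i) x ^+ 2.
Proof. by rewrite sqr_sqrtr// sum_sqr_ge0. Qed.

Lemma step_norm_adapted k : adapted k (step_norm k).
Proof.
move=> x y axy; rewrite /step_norm; congr Num.sqrt; apply: eq_bigr => i _.
by rewrite (cexp_adapted _ axy).
Qed.

Definition vnorm x := Num.sqrt (\sum_i M i x ^+ 2).

Lemma step_norm_le_cexp k x : step_norm k x <= cexp k vnorm x.
Proof.
have [->|n0] := eqVneq (step_norm k x) 0.
  by apply: cexp_ge0 => y; exact: sqrtr_ge0.
have np : 0 < step_norm k x by rewrite lt_neqAle eq_sym n0 step_norm_ge0.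
rewrite -(ler_pM2l np) -expr2 step_norm_sq.
have -> : \sum_i cexp k (M i) x ^+ 2 =
    cexp k (fun y => \sum_i cexp k (M i) y * M i y) x.
  rewrite /cexp exchange_big /= mulr_suml; apply: eq_bigr => i _.
  by rewrite expr2 -(cexp_const _ _ (@cexp_adapted k (M i))).
rewrite -(cexp_const _ _ (@step_norm_adapted k)); apply: le_cexp => y.
exact: cauchy_schwarz_sum.
Qed.

(** Increments after time [j] are orthogonal to the past, also against weights
  known at time [j]. *)
Lemma martingale_orthogonality j k g : (j <= k)%N -> (k <= N)%N -> adapted j g ->
  \sum_x g x * (\sum_i (cexp k (M i) x - cexp j (M i) x) ^+ 2) =
  \sum_x g x * (step_norm k x ^+ 2 - step_norm j x ^+ 2).
Proof.
move=> jk kN gj.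
under eq_bigr => x _ do rewrite mulr_sumr.
under [RHS]eq_bigr => x _ do rewrite !step_norm_sq -sumrB mulr_sumr.
rewrite exchange_big [RHS]exchange_big /=; apply: eq_bigr => i _.
set A := cexp k (M i); set B := cexp j (M i).
have gB : adapted j (fun x => g x * B x).
  by move=> x y axy; rewrite (gj _ _ axy) /B (cexp_adapted _ axy).
have E : \sum_x g x * B x * A x = \sum_x g x * B x * B x.
  by rewrite (sum_cexp _ (adaptedW jk kN gB)) (sum_cexp _ gB).
rewrite -[LHS](addrK (2 * \sum_x g x * B x * A x)) {2}E.
rewrite !mulr_sumr -big_split -sumrB; apply: eq_bigr => x _ /=; ring.
Qed.

Lemma step_norm_diff_sq j k x : (step_norm k x - step_norm j x) ^+ 2 <=
  \sum_i (cexp k (M i) x - cexp j (M i) x) ^+ 2.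
Proof.
have := cauchy_schwarz_sum (fun i => cexp k (M i) x) (fun i => cexp j (M i) x).
rewrite -/(step_norm k x) -/(step_norm j x) => H.
have -> : \sum_i (cexp k (M i) x - cexp j (M i) x) ^+ 2 =
  step_norm k x ^+ 2 + step_norm j x ^+ 2 - 2 * \sum_i cexp k (M i) x * cexp j (M i) x.
  rewrite !step_norm_sq mulr_sumr -big_split -sumrB; apply: eq_bigr => i _ /=; ring.
by rewrite sqrrB; lra.
Qed.

Variables (r B : R).
Hypothesis r2 : 2 <= r.
Hypothesis B1 : 1 <= B.
Hypothesis regular : forall k x, (k < N)%N ->
  #|[pred y | a k y == a k x]|%:R <= B * #|[pred y | a k.+1 y == a k.+1 x]|%:R.
Hypothesis inj : injective (a N).
Variable X : T -> R.
Hypothesis tail : forall k x, (k <= N)%N ->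
  \sum_(y | a k y == a k x) \sum_i (M i y - cexp k (M i) y) ^+ 2 <=
  \sum_(y | a k y == a k x) X y.
Hypothesis total : forall x,
  \sum_(y | a 0%N y == a 0%N x) \sum_i (M i y) ^+ 2 <=
  \sum_(y | a 0%N y == a 0%N x) X y.

Let U := cexp_max vnorm.
Let V k x := U k x `^ (r - 2).

Let vnorm_ge0 x : 0 <= vnorm x. Proof. exact: sqrtr_ge0. Qed.

Lemma cexp_regular k f x : (k < N)%N -> (forall y, 0 <= f y) ->
  cexp k.+1 f x <= B * cexp k f x.
Proof.
move=> kN f0; rewrite /cexp ler_pdivrMr ?card_atom_gt0//.
have H : \sum_(y | a k.+1 y == a k.+1 x) f y <= \sum_(y | a k y == a k x) f y.
  rewrite [leRHS](bigID (fun y => a k.+1 y == a k.+1 x)) /=.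
  rewrite -[leLHS]addr0 lerD ?sumr_ge0//.
  rewrite le_eqVlt; apply/orP; left; apply/eqP; apply: eq_bigl => y.
  apply/idP/idP => [/eqP e|/andP[]//].
  by rewrite e eqxx andbT; apply/eqP/filt.
have := regular x kN; have := @card_atom_gt0 k x.
set n0 : R := #|[pred y | a k y == a k x]|%:R.
set n1 : R := #|[pred y | a k.+1 y == a k.+1 x]|%:R => n00 nn.
have F0 : 0 <= \sum_(y | a k y == a k x) f y by rewrite sumr_ge0.
apply: (le_trans H); set F := \sum_(_ | _) _ in F0 *.
have -> : B * (F / n0) * n1 = F * (B * n1 / n0) by ring.
by rewrite -[leLHS]mulr1 ler_wpM2l// ler_pdivlMr// mul1r.
Qed.

Lemma step_norm_le k x : step_norm k x <= U k x.
Proof. exact: le_trans (step_norm_le_cexp _ _) (cexp_le_cexp_max _ _ _). Qed.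

(** Since an atom is split into boundedly many atoms, the martingale at time
  [k.+1] is controlled by quantities known at time [k]. *)
Lemma step_normS_le k x : (k < N)%N -> step_norm k.+1 x <= B * U k x.
Proof.
move=> kN; apply: le_trans (step_norm_le_cexp _ _) _.
apply: le_trans (cexp_regular _ kN vnorm_ge0) _.
rewrite ler_wpM2l//; first exact: le_trans ler01 B1.
exact: cexp_le_cexp_max.
Qed.

Let V_ge0 k x : 0 <= V k x. Proof. exact: powR_ge0. Qed.

Let V_adapted k : (k <= N)%N -> adapted k (V k).
Proof. by move=> kN x y axy; rewrite /V /U (cexp_max_adapted vnorm kN axy). Qed.

Let V_leS k x : V k x <= V k.+1 x.
Proof.
by apply: powR_le; rewrite ?cexp_max_ge0 ?cexp_max_leS ?subr_ge0.
Qed.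

Definition ito_const := (r / 2 + r * (r - 1)) * B `^ (r - 2).

(** In the second order expansion of the [r]-th power the first order term has
  an adapted weight, so that it integrates to the square of the increment as
  well. *)
Lemma ito_step k : (k < N)%N ->
  \sum_x step_norm k.+1 x `^ r - \sum_x step_norm k x `^ r <=
  ito_const * \sum_x V k x * (step_norm k.+1 x ^+ 2 - step_norm k x ^+ 2).
Proof.
move=> kN; have B0 : 0 <= B := le_trans ler01 B1.
have r2' := r2.
rewrite -martingale_orthogonality//; last exact/V_adapted/ltnW.
pose d x := \sum_i (cexp k.+1 (M i) x - cexp k (M i) x) ^+ 2.
rewrite -/d.
have d0 x : 0 <= d x by exact: sum_sqr_ge0.
have UB x : U k x <= B * U k x.
  by rewrite -[leLHS]mul1r ler_wpM2r// cexp_max_ge0.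
have W1 x : step_norm k x `^ (r - 2) <= B `^ (r - 2) * V k x.
  rewrite -powRM ?cexp_max_ge0//; apply: powR_le; first lra.
    exact: step_norm_ge0.
  exact: le_trans (step_norm_le _ _) (UB x).
have nk : adapted k (fun x => step_norm k x `^ (r - 2)).
  by move=> x y axy; rewrite (step_norm_adapted axy).
have H : \sum_x step_norm k.+1 x `^ r - \sum_x step_norm k x `^ r <=
  r / 2 * \sum_x step_norm k x `^ (r - 2) * (step_norm k.+1 x ^+ 2 - step_norm k x ^+ 2) +
  r * (r - 1) * \sum_x B `^ (r - 2) * V k x * d x.
  rewrite -sumrB !mulr_sumr -big_split; apply: ler_sum => x _ /=.
  have Wk := le_trans (step_norm_le k x) (UB x).
  have Wk1 := step_normS_le x kN.
  have := powR_ito_step r2 (step_norm_ge0 k x) (step_norm_ge0 k.+1 x) Wk Wk1.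
  rewrite powRM ?cexp_max_ge0// -/(V k x) -mulrA => h; apply: (le_trans h).
  rewrite lerD2l -!mulrA; have r0 : 0 <= r by lra.
  have r10 : 0 <= r - 1 by lra.
  apply: (ler_wpM2l r0); apply: (ler_wpM2l r10).
  apply: (ler_wpM2l (powR_ge0 _ _)); apply: (ler_wpM2l (V_ge0 _ _)).
  exact: step_norm_diff_sq.
apply: (le_trans H).
rewrite -martingale_orthogonality//.
rewrite -/d.
have H2 : \sum_x step_norm k x `^ (r - 2) * d x <=
          \sum_x B `^ (r - 2) * V k x * d x.
  by apply: ler_sum => x _; rewrite ler_wpM2r.
have E : ito_const * \sum_x V k x * d x =
  (r / 2 + r * (r - 1)) * \sum_x B `^ (r - 2) * V k x * d x.
  rewrite /ito_const -mulrA; congr (_ * _); rewrite mulr_sumr.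
  by apply: eq_bigr => x _; rewrite mulrA.
rewrite E mulrDl lerD2r ler_wpM2l//; lra.
Qed.

Let S m := \sum_x V 0 x * step_norm 0 x ^+ 2 +
  \sum_(k < m) \sum_x V k x * (step_norm k.+1 x ^+ 2 - step_norm k x ^+ 2).

(** Summation by parts moves the differences from the norms to the weights
  [V], where they are nonnegative and adapted, so that the energy that remains
  after step [m] can be replaced with [X]. *)
Lemma abel_bound m : (m <= N)%N ->
  S m + \sum_x V m x * (step_norm N x ^+ 2 - step_norm m x ^+ 2) <= \sum_x V m x * X x.
Proof.
elim: m => [_|m IH mN].
  rewrite /S big_ord0 addr0 -big_split /=.
  under eq_bigr => x _ do rewrite -mulrDr addrC subrK step_norm_sq.
  apply: (@sum_adapted_le 0) => //; first exact: V_adapted.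
  move=> x; apply: le_trans (total x); rewrite le_eqVlt; apply/orP; left.
  apply/eqP; apply: eq_bigr => y _; apply: eq_bigr => i _.
  by rewrite cexp_id.
pose D x := V m.+1 x - V m x.
have D0 x : 0 <= D x by rewrite subr_ge0.
have Dad : adapted m.+1 D.
  move=> x y axy; rewrite /D (V_adapted mN axy).
  by rewrite (V_adapted (ltnW mN) (filt mN axy)).
have DX : \sum_x D x * (step_norm N x ^+ 2 - step_norm m.+1 x ^+ 2) <= \sum_x D x * X x.
  rewrite -martingale_orthogonality//.
  apply: (@sum_adapted_le m.+1) => // x.
  apply: le_trans (tail x mN); rewrite le_eqVlt; apply/orP; left.
  apply/eqP; apply: eq_bigr => y _; apply: eq_bigr => i _.
  by rewrite cexp_id.
have E1 : \sum_x V m.+1 x * X x = \sum_x V m x * X x + \sum_x D x * X x.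
  by rewrite -big_split; apply: eq_bigr => x _ /=; rewrite /D; ring.
have E2 : \sum_x V m x * (step_norm m.+1 x ^+ 2 - step_norm m x ^+ 2) +
    \sum_x V m.+1 x * (step_norm N x ^+ 2 - step_norm m.+1 x ^+ 2) =
    \sum_x V m x * (step_norm N x ^+ 2 - step_norm m x ^+ 2) +
    \sum_x D x * (step_norm N x ^+ 2 - step_norm m.+1 x ^+ 2).
  by rewrite -!big_split; apply: eq_bigr => x _ /=; rewrite /D; ring.
rewrite E1; apply: le_trans (lerD (IH (ltnW mN)) DX).
by rewrite /S big_ord_recr /= -[leRHS]addrA -E2 !addrA.
Qed.

Lemma ito_const_ge1 : 1 <= ito_const.
Proof.
have r2' := r2; rewrite /ito_const -[leLHS]mulr1 ler_pM//; first by nra.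
by rewrite -[leLHS](powRr0 B) ler_powR// subr_ge0.
Qed.

Lemma step_norm_pow_le m : (m <= N)%N -> \sum_x step_norm m x `^ r <= ito_const * S m.
Proof.
have r2' := r2; elim: m => [_|m IH mN].
  rewrite /S big_ord0 addr0 -[leLHS]mul1r ler_pM ?ito_const_ge1//.
    by apply: sumr_ge0 => x _; exact: powR_ge0.
  apply: ler_sum => x _; rewrite (powR_split2 r2) ?step_norm_ge0// mulrC.
  rewrite ler_wpM2r ?sqr_ge0//; apply: powR_le; first lra.
    exact: step_norm_ge0.
  exact: step_norm_le.
have := lerD (IH (ltnW mN)) (ito_step mN).
by rewrite addrC subrK -mulrDr /S big_ord_recr /= -addrA.
Qed.

Lemma vnorm_pow_le : \sum_x vnorm x `^ r <= ito_const * \sum_x V N x * X x.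
Proof.
have E x : step_norm N x = vnorm x.
  by congr Num.sqrt; apply: eq_bigr => i _; rewrite cexp_id.
have := step_norm_pow_le (leqnn N).
under eq_bigr => x _ do rewrite E.
move=> H; apply: (le_trans H); rewrite ler_wpM2l//; first exact: le_trans ito_const_ge1.
apply: le_trans (abel_bound (leqnn N)).
rewrite -[leLHS]addr0 lerD2l sumr_ge0// => x _.
by rewrite subrr mulr0.
Qed.

End vector_martingale.

End filtration.

(** The norm is expanded by the second order Taylor bound, and the weights of
  the squared increments are replaced with powers of the running maximum of
  the conditional expectations of the final norm.  Summation by parts moves
  these monotone weights onto the energies that remain after each step, which
  the hypothesis compares with [X] on every atom; the maximal inequality then
  absorbs the maximal function.  Local control of remaining energies thus
  plays the role of a square function in Burkholder's inequality. *)
Lemma local_energy_bound (R : realType) (r B : R) : 2 <= r -> 1 <= B ->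
  exists2 K : R, 0 < K &
  forall (T I : finType) (a : nat -> T -> nat) (N : nat)
    (M : I -> T -> R) (X : T -> R),
  (forall k x y, (k < N)%N -> a k.+1 x = a k.+1 y -> a k x = a k y) ->
  (forall k x, (k < N)%N -> #|[pred y | a k y == a k x]|%:R <=
     B * #|[pred y | a k.+1 y == a k.+1 x]|%:R) ->
  injective (a N) -> (forall x, 0 <= X x) ->
  (forall k x, (k <= N)%N ->
    \sum_(y | a k y == a k x) \sum_i (M i y - cexp a k (M i) y) ^+ 2 <=
    \sum_(y | a k y == a k x) X y) ->
  (forall x, \sum_(y | a 0%N y == a 0%N x) \sum_i (M i y) ^+ 2 <=
    \sum_(y | a 0%N y == a 0%N x) X y) ->
  \sum_x (\sum_i M i x ^+ 2) `^ (r / 2) <= K * \sum_x X x `^ (r / 2).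
Proof.
move=> r2 B1; pose C := ito_const r B.
pose D : R := 4 * 4^-1 `^ (1 - r).
have C1 : 1 <= C by exact: ito_const_ge1.
have C0 : 0 < C by exact: lt_le_trans C1.
have D0 : 0 < D by rewrite /D mulr_gt0// powR_gt0// invr_gt0.
(* Small enough for the power of the maximal function to be absorbed. *)
pose d := (2 * C * D)^-1.
have d0 : 0 < d by rewrite invr_gt0 mulr_gt0// mulr_gt0.
pose c := d `^ (- ((r - 2) / 2)).
have c0 : 0 < c by exact: powR_gt0.
exists (2 * C * c); first by rewrite mulr_gt0// mulr_gt0.
move=> T I a N M X filt reg inj X0 tail total.
have vE x : (\sum_i M i x ^+ 2) `^ (r / 2) = vnorm M x `^ r.
  by rewrite -[RHS]powR_sq ?sqrtr_ge0// sqr_sqrtr// sum_sqr_ge0.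
rewrite (eq_bigr _ (fun x _ => vE x)).
have H := vnorm_pow_le filt r2 B1 reg inj tail total.
have v0 x : 0 <= vnorm M x by exact: sqrtr_ge0.
have Y : \sum_x cexp_max a (vnorm M) N x `^ (r - 2) * X x <=
   d * (\sum_x cexp_max a (vnorm M) N x `^ r) + c * \sum_x X x `^ (r / 2).
  rewrite !mulr_sumr -big_split; apply: ler_sum => x _ /=.
  have r20 : 0 <= r - 2 by lra.
  have := @powR_young R (r - 2) 2 d (cexp_max a (vnorm M) N x) (X x) r20.
  by rewrite subrK; apply => //; exact: cexp_max_ge0.
have Z := doob filt v0 r2.
have {}Y := le_trans Y (lerD (ler_wpM2l (ltW d0) Z) (lexx _)).
have {}H := le_trans H (ler_wpM2l (ltW C0) Y).
have CdD : C * (d * D) = 2^-1 by rewrite /d; field; rewrite !gt_eqF.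
move: H; rewrite -/D -/C; set Sv := \sum_x vnorm M x `^ r.
set SX := \sum_x X x `^ _ => H.
have {}H : Sv <= C * (d * D) * Sv + C * c * SX.
  by apply: le_trans H _; rewrite mulrDr !mulrA.
by rewrite CdD in H; lra.
Qed.

(** * Complex numbers *)

Section complex_numbers.
Context {R : realType}.
Implicit Types z u : R[i].

Lemma Re_sum (I : Type) (s : seq I) (P : pred I) (F : I -> R[i]) :
  complex.Re (\sum_(i <- s | P i) F i) = \sum_(i <- s | P i) complex.Re (F i).
Proof. by apply: (big_morph (@complex.Re R)) => // -[a b] [c d]. Qed.

Lemma Im_sum (I : Type) (s : seq I) (P : pred I) (F : I -> R[i]) :
  complex.Im (\sum_(i <- s | P i) F i) = \sum_(i <- s | P i) complex.Im (F i).
Proof. by apply: (big_morph (@complex.Im R)) => // -[a b] [c d]. Qed.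

Lemma ReD z u : complex.Re (z + u) = complex.Re z + complex.Re u.
Proof. by case: z u => a b [c d]. Qed.

Lemma ReB z u : complex.Re (z - u) = complex.Re z - complex.Re u.
Proof. by case: z u => a b [c d]. Qed.

Lemma ImB z u : complex.Im (z - u) = complex.Im z - complex.Im u.
Proof. by case: z u => a b [c d]. Qed.

Lemma ReM z u : complex.Re (z * u) =
  complex.Re z * complex.Re u - complex.Im z * complex.Im u.
Proof. by case: z u => a b [c d]. Qed.

Lemma ImM z u : complex.Im (z * u) =
  complex.Re z * complex.Im u + complex.Im z * complex.Re u.
Proof. by case: z u => a b [c d]. Qed.

Lemma Re_natM n z : complex.Re (n%:R * z) = n%:R * complex.Re z.
Proof.
rewrite !mulr_natl; elim: n => [|n IH]; first by rewrite !mulr0n.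
by rewrite !mulrS -IH; case: z {IH} => a b; case: (_ *+ n).
Qed.

Lemma Im_natM n z : complex.Im (n%:R * z) = n%:R * complex.Im z.
Proof.
rewrite !mulr_natl; elim: n => [|n IH]; first by rewrite !mulr0n.
by rewrite !mulrS -IH; case: z {IH} => a b; case: (_ *+ n).
Qed.

Lemma normc_ge0 z : 0 <= normc z.
Proof. by case: z => a b; exact: sqrtr_ge0. Qed.

Lemma normc_sq z : normc z ^+ 2 = complex.Re z ^+ 2 + complex.Im z ^+ 2.
Proof. by case: z => a b /=; rewrite sqr_sqrtr// addr_ge0 ?sqr_ge0. Qed.

Lemma mulcJ z : z * z^*%C = ((normc z ^+ 2)%:C)%C.
Proof.
rewrite normc_sq; case: z => a b /=; apply/eqP; rewrite eq_complex /=.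
by apply/andP; split; apply/eqP; ring.
Qed.

Lemma conjcM z u : (z * u)^*%C = z^*%C * u^*%C.
Proof. exact: rmorphM. Qed.

Lemma normc_conj z : normc z^*%C = normc z.
Proof. by case: z => a b /=; rewrite sqrrN. Qed.

Lemma normcX z n : normc (z ^+ n) = normc z ^+ n.
Proof.
elim: n => [|n IH]; first by rewrite !expr0 normc1.
by rewrite !exprS normcM IH.
Qed.

Lemma Re_le_normc z : complex.Re z <= normc z.
Proof.
have [h|h] := leP (complex.Re z) 0; first exact: le_trans h (normc_ge0 _).
rewrite -(@ler_pXn2r _ 2)// ?nnegrE ?normc_ge0 ?(ltW h)//.
by rewrite normc_sq lerDl sqr_ge0.
Qed.

Lemma cexpiD (s t : R) : cexpi (s + t) = cexpi s * cexpi t.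
Proof.
apply/eqP; rewrite eq_complex /= cosD sinD; apply/andP.
by split; apply/eqP; ring.
Qed.

Lemma cexpi0 : cexpi (0 : R) = 1.
Proof. by rewrite /cexpi cos0 sin0. Qed.

Lemma cexpi_conj (t : R) : (cexpi t)^*%C = cexpi (- t).
Proof. by rewrite /cexpi /= cosN sinN. Qed.

Lemma cexpi_norm (t : R) : normc (cexpi t) = 1.
Proof. by rewrite /cexpi /= cos2Dsin2 sqrtr1. Qed.

Lemma cexpi_nat (t : R) n : cexpi t ^+ n = cexpi (t * n%:R).
Proof.
elim: n => [|n IH]; first by rewrite expr0 mulr0 cexpi0.
by rewrite exprS IH -cexpiD -natr1 mulrDr mulr1 addrC.
Qed.

Lemma cexpi_2pi : cexpi (2 * pi : R) = 1.
Proof. by rewrite /cexpi mulr_natl cos2pi sin2pi. Qed.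

Lemma cexpi_eq1 (t : R) : 0 < t < 2 * pi -> cexpi t <> 1.
Proof.
move=> /andP[t0 t2] [H _].
have S : 0 < sin (t / 2) by rewrite sin_gt0_pi//; apply/andP; split; lra.
have : cos t = 1 - 2 * sin (t / 2) ^+ 2.
  have -> : t = t / 2 + t / 2 by field.
  rewrite cosD -!expr2 cos2sin2; have -> : (t / 2 + t / 2) / 2 = t / 2 by field.
  ring.
by rewrite H => e; have := exprn_gt0 2 S; lra.
Qed.

End complex_numbers.

(** * Vilenkin functions and the Dirichlet kernel *)

Section vilenkin_characters.
Context {R : realType} (ps : nat -> nat).
Hypothesis ps2 : forall i, (0 < i)%N -> (2 <= ps i)%N.
Local Notation m := (vil_m ps).
Implicit Types x y : R.

Definition cell k (x : R) : nat := Num.truncn ((m k)%:R * x).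

Let m_gt0 k : (0 < m k)%N. Proof. exact: vil_m_gt0. Qed.
Let p_gt0 k : (0 < ps k.+1)%N. Proof. exact: leq_trans (ps2 _). Qed.

Lemma cell0 x : 0 <= x < 1 -> cell 0 x = 0%N.
Proof.
move=> x01; apply: truncn_def; rewrite /vil_m big_geq// mul1r; exact: x01.
Qed.

Lemma cellS_div k x : 0 <= x -> cell k x = (cell k.+1 x %/ ps k.+1)%N.
Proof.
move=> x0; set c := (_ %/ _)%N.
have P0 : 0 < (ps k.+1)%:R :> R by rewrite ltr0n p_gt0.
have := @truncn_itv R ((m k.+1)%:R * x) (mulr_ge0 (ler0n _ _) x0).
rewrite -/(cell k.+1 x) => /andP[h1 h2]; apply: truncn_def.
have E : (m k.+1)%:R * x = (m k)%:R * x * (ps k.+1)%:R.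
  by rewrite vil_mS natrM mulrAC.
rewrite E in h1 h2; apply/andP; split.
  rewrite -(ler_pM2r P0); apply: le_trans h1.
  by rewrite -natrM ler_nat leq_divM.
rewrite -(ltr_pM2r P0); apply: (lt_le_trans h2).
by rewrite -natrM ler_nat ltn_ceil.
Qed.

Lemma cell_coarse j k x y : (j <= k)%N -> 0 <= x -> 0 <= y ->
  cell k x = cell k y -> cell j x = cell j y.
Proof.
move=> /subnKC <- x0 y0; elim: (k - j)%N => [|d IH]; first by rewrite addn0.
rewrite addnS => e; apply: IH.
by rewrite (cellS_div _ x0) (cellS_div _ y0) e.
Qed.

Lemma rademacherE k x : 0 <= x ->
  vil_rademacher ps k x = cexpi (2 * pi / (ps k)%:R * (cell k x)%:R).
Proof.
move=> x0; rewrite /vil_rademacher /cell; congr cexpi.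
rewrite truncn_floor mulr_ge0//.
have : 0 <= Num.floor ((m k)%:R * x) by rewrite floor_ge0 mulr_ge0.
case: (Num.floor _) => // n _; rewrite absz_nat.
by rewrite mulrAC.
Qed.

Lemma rademacher_norm k x : normc (vil_rademacher ps k x) = 1.
Proof. exact: cexpi_norm. Qed.

Lemma rademacher_conj k x :
  vil_rademacher ps k x * (vil_rademacher ps k x)^*%C = 1.
Proof. by rewrite mulcJ rademacher_norm expr1n. Qed.

Lemma geometric_sum_root (z : R[i]) n : z ^+ n = 1 -> z != 1 ->
  \sum_(d < n) z ^+ d = 0.
Proof.
move=> zn z1; have := subrX1 z n; rewrite zn subrr => /esym/eqP.
by rewrite mulf_eq0 subr_eq0 (negbTE z1) => /eqP.
Qed.

(** Orthogonality of the characters of the cyclic group of the [k.+1]-st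
  digit, for two points that agree in the preceding digits. *)
Lemma rademacher_kernel k x y : 0 <= x -> 0 <= y -> cell k x = cell k y ->
  \sum_(d < ps k.+1) vil_rademacher ps k.+1 x ^+ d *
      (vil_rademacher ps k.+1 y ^+ d)^*%C =
  if cell k.+1 x == cell k.+1 y then (ps k.+1)%:R else 0.
Proof.
move=> x0 y0 exy; set rx := vil_rademacher _ _ x; set ry := vil_rademacher _ _ y.
have -> : \sum_(d < ps k.+1) rx ^+ d * (ry ^+ d)^*%C =
          \sum_(d < ps k.+1) (rx * ry^*%C) ^+ d.
  by apply: eq_bigr => d _; rewrite rmorphXn exprMn.
have [e|ne] := eqVneq (cell k.+1 x) (cell k.+1 y).
  have -> : rx = ry by rewrite /rx /ry !rademacherE// e.
  rewrite rademacher_conj; under eq_bigr do rewrite expr1n.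
  by rewrite sumr_const card_ord.
have P0 : 0 < (ps k.+1)%:R :> R by rewrite ltr0n p_gt0.
have root u : (0 <= u) -> vil_rademacher ps k.+1 u ^+ ps k.+1 = 1 :> R[i].
  move=> u0; rewrite rademacherE// cexpi_nat.
  have -> : 2 * pi / (ps k.+1)%:R * (cell k.+1 u)%:R * (ps k.+1)%:R =
     (2 * pi) * (cell k.+1 u)%:R :> R by field; rewrite gt_eqF.
  by rewrite -cexpi_nat cexpi_2pi expr1n.
apply: geometric_sum_root.
  by rewrite exprMn -rmorphXn /= !root// conjc1 mulr1.
have K u v : 0 <= u -> 0 <= v -> cell k u = cell k v ->
    (cell k.+1 u < cell k.+1 v)%N ->
    vil_rademacher ps k.+1 v * (vil_rademacher ps k.+1 u)^*%C != 1.
  move=> u0 v0 euv uv; apply/eqP.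
  rewrite !rademacherE// cexpi_conj -cexpiD -mulrBr; apply: cexpi_eq1.
  have d1 : 0 < (cell k.+1 v)%:R - (cell k.+1 u)%:R :> R.
    by rewrite subr_gt0 ltr_nat.
  have d2 : (cell k.+1 v)%:R - (cell k.+1 u)%:R < (ps k.+1)%:R :> R.
    rewrite ltrBlDl -natrD ltr_nat.
    rewrite (divn_eq (cell k.+1 v) (ps k.+1)) (divn_eq (cell k.+1 u) (ps k.+1)).
    rewrite -(cellS_div _ u0) -(cellS_div _ v0) euv -addnA ltn_add2l.
    by rewrite (leq_trans (ltn_pmod _ (p_gt0 _)))// leq_addl.
  have pi0 := pi_gt0 R.
  apply/andP; split; first by rewrite mulr_gt0// divr_gt0// mulr_gt0.
  have -> : 2 * pi / (ps k.+1)%:R * ((cell k.+1 v)%:R - (cell k.+1 u)%:R) =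
    2 * pi * (((cell k.+1 v)%:R - (cell k.+1 u)%:R) / (ps k.+1)%:R) :> R.
    by field; rewrite gt_eqF.
  by rewrite -[ltRHS]mulr1 ltr_pM2l ?mulr_gt0// ltr_pdivrMr// mul1r.
move: ne; rewrite neq_ltn => /orP[lt|lt]; last exact: K.
have := K _ _ x0 y0 exy lt; rewrite -/rx -/ry; apply: contraNneq => H.
by rewrite -conjc1 -H conjcM conjcK mulrC.
Qed.

Lemma vil_digit_big k n : (0 < k)%N -> (n < m k.-1)%N -> vil_digit ps k n = 0%N.
Proof. by move=> k0 nk; rewrite /vil_digit divn_small// mod0n. Qed.

Lemma m_le j k : (j <= k)%N -> (m j <= m k)%N.
Proof. by move=> jk; rewrite dvdn_leq ?m_gt0// vil_m_dvd. Qed.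

Lemma vil_w_prod L n x : (n < m L)%N -> vil_w ps n x =
  \prod_(1 <= k < L.+1) vil_rademacher ps k x ^+ vil_digit ps k n.
Proof.
have ext L1 L2 : (L1 <= L2)%N -> (n < m L1)%N ->
    \prod_(1 <= k < L1.+1) vil_rademacher ps k x ^+ vil_digit ps k n =
    \prod_(1 <= k < L2.+1) vil_rademacher ps k x ^+ vil_digit ps k n.
  move=> L12 nL; rewrite [RHS](@big_cat_nat _ _ _ L1.+1) ?ltnS//=.
  rewrite [X in _ = _ * X]big1_seq ?mulr1// => k.
  rewrite mem_index_iota => /andP[_ /andP[k1 k2]].
  rewrite vil_digit_big ?expr0 ?(leq_trans _ k1)//.
  by rewrite (leq_trans nL)// m_le// -ltnS prednK ?(leq_trans _ k1).
move=> nL; rewrite /vil_w (ext n (maxn n L)) ?leq_maxl//; last first.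
  by rewrite (leq_trans (ltn_expl n (ltnSn 1)))// vil_m_exp.
by rewrite (ext L (maxn n L)) ?leq_maxr.
Qed.

Lemma vil_digitD k c j i : (0 < i)%N -> (j < m k)%N ->
  vil_digit ps i (c * m k + j) = (vil_digit ps i (c * m k) + vil_digit ps i j)%N.
Proof.
move=> i0 jk; have [ik|ki] := leqP i k.
  have /dvdnP[q qE] : (m i.-1 * ps i %| m k)%N.
    by rewrite -{2}(prednK i0) -vil_mS prednK// vil_m_dvd.
  have mE : (c * m k = c * q * ps i * m i.-1)%N.
    by rewrite qE !mulnA mulnAC.
  rewrite /vil_digit mE mulnK ?m_gt0// modnMl add0n.
  by rewrite divnMDl ?m_gt0// modnMDl.
have /dvdnP[q qE] : (m k %| m i.-1)%N by rewrite vil_m_dvd// -ltnS prednK.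
rewrite (@vil_digit_big i j)// ?addn0; last first.
  by rewrite (leq_trans jk)// m_le// -ltnS prednK.
rewrite /vil_digit qE [(q * _)%N]mulnC !divnMA.
by rewrite divnMDl ?m_gt0// (divn_small jk) addn0 mulnK ?m_gt0.
Qed.

(** Blocks of [vil_m ps k] consecutive frequencies are translates of the first
  one: the digits of the two summands do not overlap. *)
Lemma vil_wD k c j x : (j < m k)%N ->
  vil_w ps (c * m k + j) x = vil_w ps (c * m k) x * vil_w ps j x.
Proof.
move=> jk; set L := (c * m k + j)%N.
have nL n : (n <= L)%N -> (n < m L)%N.
  by move=> nl; rewrite (leq_ltn_trans nl)// (leq_trans (ltn_expl L (ltnSn 1)))// vil_m_exp.
rewrite !(@vil_w_prod L) ?nL ?leq_addr ?leq_addl//.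
rewrite -big_split /= !big_seq; apply: eq_bigr => i.
rewrite mem_index_iota => /andP[i0 _].
by rewrite vil_digitD// exprD.
Qed.

Lemma vil_w_norm n x : normc (vil_w ps n x) = 1.
Proof.
rewrite /vil_w (big_morph (@normc R) (@normcM R) (@normc1 R)).
by rewrite big1// => i _; rewrite normcX rademacher_norm expr1n.
Qed.

Lemma vil_w_conj n x : vil_w ps n x * (vil_w ps n x)^*%C = 1.
Proof. by rewrite mulcJ vil_w_norm expr1n. Qed.

Lemma vil_w0 x : vil_w ps 0 x = 1.
Proof. by rewrite /vil_w big_geq. Qed.

Lemma vil_w_cell k n x y : (n < m k)%N -> 0 <= x -> 0 <= y ->
  cell k x = cell k y -> vil_w ps n x = vil_w ps n y.
Proof.
move=> nk x0 y0 e; rewrite (vil_w_prod x nk) (vil_w_prod y nk) !big_seq.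
apply: eq_bigr => i; rewrite mem_index_iota => /andP[_ ik].
rewrite ltnS in ik.
by rewrite (rademacherE _ x0) (rademacherE _ y0) (cell_coarse ik x0 y0 e).
Qed.

Lemma vil_w_digit k d x : (d < ps k.+1)%N ->
  vil_w ps (d * m k) x = vil_rademacher ps k.+1 x ^+ d.
Proof.
move=> dp; rewrite (@vil_w_prod k.+1); last by rewrite vil_mS mulnC ltn_pmul2l ?m_gt0.
rewrite big_nat_recr//= big1_seq ?mul1r.
  by rewrite /vil_digit /= mulnK ?m_gt0// modn_small.
move=> i /=; rewrite mem_index_iota => /andP[i0 ik].
have /dvdnP[q qE] : (m i.-1 * ps i %| m k)%N.
  by rewrite -{2}(prednK i0) -vil_mS prednK// vil_m_dvd.
rewrite /vil_digit qE [(m i.-1 * _)%N]mulnC !mulnA mulnK ?m_gt0//.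
by rewrite modnMl expr0.
Qed.

(** Paley's lemma, one digit at a time: the Dirichlet kernel of order
  [vil_m ps k] is the kernel of the conditional expectation on the cells of
  level [k]. *)
Lemma dirichlet_kernel k x y : 0 <= x < 1 -> 0 <= y < 1 ->
  \sum_(n < m k) vil_w ps n x * (vil_w ps n y)^*%C =
  if cell k x == cell k y then (m k)%:R else 0.
Proof.
move=> x01 y01; have [/andP[x0 _] /andP[y0 _]] := (x01, y01).
elim: k => [|k IH].
  rewrite !cell0// eqxx.
  rewrite (eq_bigr (fun=> 1)) => [|n _]; last first.
    suff -> : n = 0%N :> nat by rewrite !vil_w0 conjc1 mulr1.
    apply/eqP; rewrite -leqn0 -ltnS; have := ltn_ord n.
    by rewrite {2}/vil_m big_geq.
  by rewrite sumr_const card_ord.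
rewrite -(big_mkord xpredT (fun n => vil_w ps n x * (vil_w ps n y)^*%C)).
rewrite vil_mS mulnC big_nat_mul.
have E d : (d < ps k.+1)%N ->
  \sum_(d * m k <= j < d.+1 * m k) vil_w ps j x * (vil_w ps j y)^*%C =
  vil_rademacher ps k.+1 x ^+ d * (vil_rademacher ps k.+1 y ^+ d)^*%C *
  \sum_(n < m k) vil_w ps n x * (vil_w ps n y)^*%C.
  move=> dp; rewrite -[in X in index_iota X _](add0n (d * m k)%N) big_addn.
  rewrite mulSn addnK big_mkord mulr_sumr; apply: eq_bigr => j _.
  rewrite addnC !vil_wD// rmorphM !vil_w_digit//; ring.
rewrite big_mkord (eq_bigr _ (fun (d : 'I__) _ => E d (ltn_ord d))) -mulr_suml IH.
have [e|ne] := eqVneq (cell k x) (cell k y).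
  rewrite rademacher_kernel//; case: ifP => _; last by rewrite mul0r.
  by rewrite natrM.
rewrite mulr0 ifN//; apply: contraNneq ne => e.
exact/eqP/(cell_coarse (leqnSn k) x0 y0 e).
Qed.

End vilenkin_characters.

(** * Harmonic analysis on a finite grid *)

Section grid.
Context {R : realType} (ps : nat -> nat).
Hypothesis ps2 : forall i, (0 < i)%N -> (2 <= ps i)%N.
Local Notation m := (vil_m ps).
Variable N : nat.
Local Notation M := (m N).

Definition gridpt (i : nat) : R := i%:R / M%:R.

Definition gridcell k (i : 'I_M) : nat := cell ps k (gridpt i).

Definition gridw n (i : 'I_M) : R[i] := vil_w ps n (gridpt i).

Let M_gt0 : (0 < M)%N. Proof. exact: vil_m_gt0. Qed.
Let MR_gt0 : 0 < M%:R :> R. Proof. by rewrite ltr0n. Qed.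
Let MC_neq0 : M%:R != 0 :> R[i]. Proof. by rewrite pnatr_eq0 -lt0n. Qed.
Let m_gt0 k : (0 < m k)%N. Proof. exact: vil_m_gt0. Qed.

Lemma gridpt01 (i : 'I_M) : 0 <= gridpt i < 1.
Proof. by rewrite divr_ge0//= ltr_pdivrMr// mul1r ltr_nat. Qed.

Let gridpt0 (i : 'I_M) : 0 <= gridpt i.
Proof. by have /andP[] := gridpt01 i. Qed.

Lemma gridcellN (i : 'I_M) : gridcell N i = i.
Proof.
apply: truncn_def; rewrite /gridpt mulrC divfK ?gt_eqF//.
by rewrite lexx/= ltr_nat.
Qed.

Lemma gridcell_inj : injective (gridcell N).
Proof. by move=> i j; rewrite !gridcellN => /ord_inj. Qed.

Lemma gridcell_coarse j k (x y : 'I_M) : (j <= k)%N ->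
  gridcell k x = gridcell k y -> gridcell j x = gridcell j y.
Proof. by move=> jk; exact: cell_coarse. Qed.

Lemma grid_kernel k (i j : 'I_M) :
  \sum_(n < m k) gridw n i * (gridw n j)^*%C =
  if gridcell k i == gridcell k j then (m k)%:R else 0.
Proof. by rewrite dirichlet_kernel// gridpt01. Qed.

(** The kernel identity at the finest level says that the matrix of the
  characters is a multiple of a unitary one, so its columns are orthogonal as
  well as its rows. *)
Lemma grid_orthogonal (n n' : 'I_M) :
  \sum_i gridw n i * (gridw n' i)^*%C = if n == n' then M%:R else 0.
Proof.
pose A : 'M[R[i]]_M := \matrix_(i, n) gridw n i.
pose A' : 'M[R[i]]_M := \matrix_(n, i) (M%:R^-1 * (gridw n i)^*%C).
have /mulmx1C : A *m A' = 1%:M.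
  apply/matrixP => i j; rewrite !mxE.
  under eq_bigr => k _ do rewrite !mxE mulrCA.
  rewrite -mulr_sumr grid_kernel !gridcellN -val_eqE /=.
  by case: eqP => _; rewrite ?mulr0// mulVf.
move/matrixP => /(_ n' n); rewrite !mxE.
under eq_bigr => k _ do rewrite !mxE -mulrA.
rewrite -mulr_sumr => /(congr1 ( *%R M%:R)); rewrite mulrA mulfV// mul1r.
under eq_bigr => k _ do rewrite mulrC.
by move=> ->; rewrite eq_sym; case: eqP => _; rewrite ?mulr0 ?mulr1.
Qed.

(** Fourier coefficients and spectral projections of functions of the grid
  points [i / vil_m ps N], which stand for the step functions constant on the
  cells of level [N]. *)
Definition grid_coef (h : 'I_M -> R[i]) (n : nat) : R[i] :=
  M%:R^-1 * \sum_i h i * (gridw n i)^*%C.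

Definition grid_proj (A : pred nat) (h : 'I_M -> R[i]) (i : 'I_M) : R[i] :=
  \sum_(n < M | A n) grid_coef h n * gridw n i.

Lemma grid_coef_sum (A : pred nat) (c : nat -> R[i]) (n : 'I_M) :
  grid_coef (fun i => \sum_(k < M | A k) c k * gridw k i) n = if A n then c n else 0.
Proof.
rewrite /grid_coef; under eq_bigr => i _ do rewrite mulr_suml.
rewrite exchange_big /=.
under eq_bigr => k _.
  under eq_bigr => i _ do rewrite -mulrA.
  rewrite -mulr_sumr grid_orthogonal; over.
rewrite mulr_sumr big_mkcond (bigD1 n) //= big1 ?addr0 => [|k kn]; last first.
  by rewrite (negbTE kn) !mulr0 if_same.
rewrite eqxx; case: ifP => // _.
by rewrite mulrCA mulVf// mulr1.
Qed.

Lemma grid_coef_proj A h (n : 'I_M) :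
  grid_coef (grid_proj A h) n = if A n then grid_coef h n else 0.
Proof. exact: (grid_coef_sum A (grid_coef h)). Qed.

Lemma grid_proj_kernel A h i :
  grid_proj A h i = M%:R^-1 *
    \sum_j (\sum_(n < M | A n) gridw n i * (gridw n j)^*%C) * h j.
Proof.
rewrite /grid_proj /grid_coef; under [in RHS]eq_bigr => j _ do rewrite mulr_suml.
rewrite exchange_big /= mulr_sumr; apply: eq_bigr => n _.
rewrite -mulrA mulr_suml; congr (_ * _); apply: eq_bigr => j _.
ring.
Qed.

Lemma grid_proj_id h i : grid_proj xpredT h i = h i.
Proof.
rewrite grid_proj_kernel; under eq_bigr => j _ do rewrite grid_kernel !gridcellN.
rewrite (bigD1 i) //= eqxx big1 ?addr0 => [|j ji].
  by rewrite mulrA mulVf// mul1r.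
by rewrite val_eqE eq_sym (negbTE ji) mul0r.
Qed.

Lemma grid_parseval h :
  \sum_i normc (h i) ^+ 2 = M%:R * \sum_(n < M) normc (grid_coef h n) ^+ 2.
Proof.
apply: (@complexI R); rewrite rmorphM !rmorph_sum rmorph_nat /=.
under eq_bigr => i _ do rewrite -mulcJ -{2}grid_proj_id /grid_proj rmorph_sum mulr_sumr.
rewrite exchange_big mulr_sumr; apply: eq_bigr => n _ /=.
rewrite -mulcJ {1}/grid_coef !mulrA mulfV// mul1r mulr_suml; apply: eq_bigr => i _.
by rewrite -/(conjc _) conjcM mulrA mulrAC.
Qed.

Lemma grid_proj_norm A h :
  \sum_i normc (grid_proj A h i) ^+ 2 =
  M%:R * \sum_(n < M | A n) normc (grid_coef h n) ^+ 2.
Proof.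
rewrite grid_parseval; congr (_ * _); rewrite [RHS]big_mkcond; apply: eq_bigr => n _.
by rewrite grid_coef_proj; case: ifP => // _; rewrite normc0 expr0n.
Qed.

Lemma grid_bessel (S : finType) (A : S -> pred nat) h :
  (forall s t n, A s n -> A t n -> s = t) ->
  \sum_i \sum_s normc (grid_proj (A s) h i) ^+ 2 <= \sum_i normc (h i) ^+ 2.
Proof.
move=> disj; rewrite exchange_big grid_parseval /=.
under eq_bigr => s _ do rewrite grid_proj_norm big_mkcond.
rewrite -mulr_sumr exchange_big /= ler_pM2l//; apply: ler_sum => n _.
rewrite -big_mkcond /=.
have [s As|none] := pickP (fun s => A s n).
  rewrite (big_pred1 s) // => t; apply/idP/eqP => [At|->//].
  exact: disj At As.
by rewrite big_pred0// sqr_ge0.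
Qed.

(** Sets of frequencies that are unions of blocks of length [vil_m ps k] have
  projections that act separately on the cells of level [k]. *)
Definition saturated k (A : pred nat) :=
  forall n n', (n %/ m k = n' %/ m k)%N -> A n = A n'.

Lemma saturated_kernel0 k A (i j : 'I_M) : (k <= N)%N -> saturated k A ->
  gridcell k i != gridcell k j ->
  \sum_(n < M | A n) gridw n i * (gridw n j)^*%C = 0.
Proof.
move=> kN sat ij; rewrite big_mkcond /=.
rewrite -(big_mkord xpredT
  (fun n => if A n then gridw n i * (gridw n j)^*%C else 0)).
have /dvdnP[q ->] : (m k %| M)%N by exact: vil_m_dvd.
rewrite big_nat_mul big1 // => c _.
rewrite -[in X in index_iota X _](add0n (c * m k)%N) big_addn.
rewrite mulSn addnK big_mkord.
have AE (l : 'I_(m k)) : A (l + c * m k)%N = A (c * m k)%N.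
  by apply: sat; rewrite addnC divnMDl// divn_small// addn0 mulnK.
under eq_bigr => l _ do rewrite AE.
case: (A _); last by rewrite big1.
under eq_bigr => l _.
  rewrite addnC /gridw !vil_wD// conjcM mulrACA; over.
rewrite -mulr_sumr; have := grid_kernel k i j.
by rewrite (negbTE ij) /gridw => ->; rewrite mulr0.
Qed.

Lemma grid_proj_local k A h (Q : nat -> bool) i : (k <= N)%N -> saturated k A ->
  Q (gridcell k i) ->
  grid_proj A (fun j => if Q (gridcell k j) then h j else 0) i = grid_proj A h i.
Proof.
move=> kN sat Qi; rewrite !grid_proj_kernel; congr (_ * _); apply: eq_bigr => j _.
have [e|ne] := eqVneq (gridcell k i) (gridcell k j); first by rewrite -e Qi.
by rewrite (saturated_kernel0 kN sat ne) !mul0r.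
Qed.

(** Modulation by a character of the same block leaves a function that is
  constant on cells. *)
Lemma gridw_div k b n (i j : 'I_M) : (n %/ m k = b %/ m k)%N ->
  gridcell k i = gridcell k j ->
  (gridw b j)^*%C * gridw n j = (gridw b i)^*%C * gridw n i.
Proof.
move=> e ij.
have H x : (vil_w ps b x)^*%C * vil_w ps n x =
   (vil_w ps (b %% m k) x)^*%C * vil_w ps (n %% m k) x :> R[i].
  rewrite {1}(divn_eq b (m k)) {1}(divn_eq n (m k)) !vil_wD ?ltn_pmod// e.
  rewrite rmorphM /= mulrACA -[RHS]mul1r; congr (_ * _).
  by rewrite mulrC vil_w_conj.
have W l : vil_w ps (l %% m k) (gridpt j) = vil_w ps (l %% m k) (gridpt i).
  exact: (vil_w_cell ps2 (ltn_pmod l (m_gt0 k)) (gridpt0 j) (gridpt0 i) (esym ij)).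
by rewrite /gridw !H !W.
Qed.

(** Characters from different blocks are orthogonal on every single cell, not
  only on the whole grid: the indicator of a cell has all its frequencies in
  the first block, and multiplication by it does not leave a block. *)
Lemma gridw_orth_cell k b n (i : 'I_M) : (k <= N)%N -> (b < M)%N -> (n < M)%N ->
  (n %/ m k != b %/ m k)%N ->
  \sum_(j | gridcell k j == gridcell k i) (gridw b j)^*%C * gridw n j = 0.
Proof.
move=> kN bM nM nb; have mC : (m k)%:R != 0 :> R[i] by rewrite pnatr_eq0 -lt0n.
apply: (mulfI mC); rewrite mulr0 mulr_sumr big_mkcond /=.
set c := (b %/ m k)%N.
have bE : b = (c * m k + b %% m k)%N by exact: divn_eq.
have E j : (if gridcell k j == gridcell k i then
      (m k)%:R * ((gridw b j)^*%C * gridw n j) else 0) =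
   \sum_(l < m k) (gridw (b %% m k) i)^*%C * gridw l i *
      (gridw n j * (gridw (c * m k + l) j)^*%C).
  have -> : \sum_(l < m k) (gridw (b %% m k) i)^*%C * gridw l i *
      (gridw n j * (gridw (c * m k + l) j)^*%C) =
     (gridw (b %% m k) i)^*%C * gridw n j * (gridw (c * m k) j)^*%C *
     \sum_(l < m k) gridw l i * (gridw l j)^*%C.
    rewrite mulr_sumr; apply: eq_bigr => l _; rewrite /gridw vil_wD// rmorphM /=.
    ring.
  rewrite grid_kernel eq_sym; case: eqP => [e|_]; last by rewrite mulr0.
  rewrite {1}bE /gridw vil_wD ?ltn_pmod// rmorphM /=.
  rewrite (@vil_w_cell _ ps ps2 k (b %% m k) (gridpt i) (gridpt j)) ?ltn_pmod//.
  ring.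
rewrite (eq_bigr _ (fun j _ => E j)) exchange_big big1 //= => l _.
rewrite -mulr_sumr.
have lM : (c * m k + l < M)%N.
  have /dvdnP[q qE] : (m k %| M)%N by exact: vil_m_dvd.
  rewrite (@leq_trans (c.+1 * m k))//; first by rewrite mulSn addnC ltn_add2r.
  by rewrite qE leq_mul2r ltn_divLR// -qE bM orbT.
rewrite (grid_orthogonal (Ordinal nM) (Ordinal lM)) -val_eqE /= ifN ?mulr0//.
apply: contraNneq nb => ->.
by rewrite divnMDl// divn_small// addn0.
Qed.

Lemma card_gridcell k (i : 'I_M) : (k <= N)%N ->
  (#|[pred j | gridcell k j == gridcell k i]| * m k)%N = M.
Proof.
move=> kN; apply/eqP; rewrite -(@eqr_nat R[i]) natrM; apply/eqP.
have H j : gridw 0 j = 1 by rewrite /gridw /vil_w big_geq.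
have := @big_mkcond _ 0 +%R _ (index_enum 'I_M) (fun j => gridcell k j == gridcell k i)
  (fun=> (m k)%:R : R[i]).
rewrite sumr_const -(mulr_natl (m k)%:R) => ->.
under eq_bigr => j _ do rewrite eq_sym -grid_kernel.
rewrite exchange_big /=.
have mM : (m k <= M)%N by rewrite m_le.
under eq_bigr => n _.
  rewrite -mulr_sumr.
  have -> : \sum_j (gridw n j)^*%C = \sum_j gridw (Ordinal M_gt0) j *
    (gridw (widen_ord mM n) j)^*%C.
    by apply: eq_bigr => j _; rewrite H mul1r.
  rewrite grid_orthogonal; over.
rewrite (bigD1 (Ordinal (m_gt0 k))) //= ?eqxx H mul1r big1 ?addr0 // => n n0.
by rewrite ifN ?mulr0// -val_eqE eq_sym.
Qed.

Variable B : nat.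
Hypothesis psB : forall i, (0 < i)%N -> (ps i <= B)%N.

Lemma gridcell_regular k (i : 'I_M) : (k < N)%N ->
  #|[pred j | gridcell k j == gridcell k i]|%:R <=
  B%:R * #|[pred j | gridcell k.+1 j == gridcell k.+1 i]|%:R :> R.
Proof.
move=> kN; rewrite -natrM ler_nat -(@leq_pmul2r (m k))//.
rewrite card_gridcell ?(ltnW kN)// -{1}(card_gridcell i kN) vil_mS.
rewrite [(m k * _)%N]mulnC mulnA [(B * _)%N]mulnC leq_mul2r leq_mul2l.
by rewrite psB// !orbT.
Qed.

End grid.

(** * The square function of a family of intervals *)

Section square_function.
Context {R : realType} (ps : nat -> nat).
Hypothesis ps2 : forall i, (0 < i)%N -> (2 <= ps i)%N.
Local Notation m := (vil_m ps).
Variable N : nat.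
Local Notation M := (m N).
Local Notation gridw := (@gridw R ps N).
Local Notation gridcell := (@gridcell R ps N).
Local Notation grid_proj := (@grid_proj R ps N).

(** Averaging a modulated projection over cells keeps the frequencies in the
  block of the modulating character. *)
Lemma grid_proj_cell_average k b (A : pred nat) h (i : 'I_M) : (k <= N)%N ->
  (b < M)%N ->
  \sum_(j | gridcell k j == gridcell k i) (gridw b j)^*%C * grid_proj A h j =
  #|[pred j | gridcell k j == gridcell k i]|%:R *
  ((gridw b i)^*%C * grid_proj [pred n | A n & n %/ m k == b %/ m k]%N h i).
Proof.
move=> kN bM; rewrite /grid_proj.
under eq_bigr => j _ do rewrite mulr_sumr.
rewrite exchange_big /= 2!mulr_sumr big_mkcondr /=; apply: eq_bigr => n An.
under eq_bigr => j _ do rewrite mulrCA.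
rewrite -mulr_sumr; case: ifPn => nb; last by rewrite gridw_orth_cell// mulr0.
rewrite (eq_bigr (fun=> (gridw b i)^*%C * gridw n i)); last first.
  by move=> j /eqP ji; exact: (gridw_div ps2 (eqP nb) (esym ji)).
rewrite sumr_const -[X in _ * X](mulr_natl (_ * _)); ring.
Qed.

Section one_family.
Variables (S : finType) (A : S -> pred nat) (b : S -> nat).
Hypothesis disj : forall s t n, A s n -> A t n -> s = t.
Hypothesis bM : forall s, (b s < M)%N.
Hypothesis sat : forall k s n n', (k <= N)%N -> (n %/ m k = n' %/ m k)%N ->
  (n %/ m k != b s %/ m k)%N -> A s n = A s n'.
Variable h : 'I_M -> R[i].

(** The coordinates of the modulated projections, a martingale with values in
  a real Euclidean space. *)
Definition modproj (t : S * bool) (i : 'I_M) : R :=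
  let z := (gridw (b t.1) i)^*%C * grid_proj (A t.1) h i in
  if t.2 then complex.Re z else complex.Im z.

(** The frequencies that have not yet entered the martingale at time [k]. *)
Definition offblock k s : pred nat :=
  [pred n | A s n & n %/ m k != b s %/ m k]%N.

Lemma offblock_saturated k s : (k <= N)%N -> saturated ps k (offblock k s).
Proof.
move=> kN n n' e; rewrite /offblock !inE -e.
have [_|ne] := eqVneq (n %/ m k)%N (b s %/ m k)%N; first by rewrite !andbF.
by rewrite !andbT (sat kN e ne).
Qed.

Lemma modproj_sub_cexp k s (i : 'I_M) : (k <= N)%N ->
  \sum_(c : bool) (modproj (s, c) i - cexp gridcell k (modproj (s, c)) i) ^+ 2
  = normc (grid_proj (offblock k s) h i) ^+ 2.
Proof.
move=> kN; have av := grid_proj_cell_average (A s) h i kN (bM s).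
set n := #|_| in av.
have n0 : n%:R != 0 :> R.
  by rewrite gt_eqF//; exact: (card_atom_gt0 gridcell k i).
set v := (gridw (b s) i)^*%C * _ in av.
have eRe : cexp gridcell k (modproj (s, true)) i = complex.Re v.
  rewrite /cexp /modproj /= -Re_sum av Re_natM -/n.
  by rewrite mulrC mulKf.
have eIm : cexp gridcell k (modproj (s, false)) i = complex.Im v.
  rewrite /cexp /modproj /= -Im_sum av Im_natM -/n.
  by rewrite mulrC mulKf.
rewrite big_bool eRe eIm /modproj /=.
have -> : grid_proj (offblock k s) h i =
  grid_proj (A s) h i - grid_proj [pred n | A s n & n %/ m k == b s %/ m k]%N h i.
  apply/eqP; rewrite eq_sym subr_eq addrC; apply/eqP.
  exact: (bigID (fun n : 'I_M => n %/ m k == b s %/ m k)%N).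
rewrite -[normc (_ - _)]mul1r -[1](vil_w_norm ps (b s) (@gridpt R ps N i)).
rewrite -normc_conj -normcM mulrBr -/(gridw (b s) i) -/v normc_sq.
by case: (_ * grid_proj (A s) h i) => ? ?; case: v {av eRe eIm}.
Qed.

Lemma modproj_sq s (i : 'I_M) :
  \sum_(c : bool) modproj (s, c) i ^+ 2 = normc (grid_proj (A s) h i) ^+ 2.
Proof.
rewrite big_bool /modproj /= -normc_sq normcM normc_conj.
by rewrite vil_w_norm mul1r.
Qed.

(** Local energy estimate: the projections onto the frequencies that remain
  commute with the restriction to a cell, and they are orthogonal. *)
Lemma modproj_tail k (i : 'I_M) : (k <= N)%N ->
  \sum_(j | gridcell k j == gridcell k i)
    \sum_t (modproj t j - cexp gridcell k (modproj t) j) ^+ 2 <=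
  \sum_(j | gridcell k j == gridcell k i) normc (h j) ^+ 2.
Proof.
move=> kN; pose Q c := c == gridcell k i.
pose g j := if Q (gridcell k j) then h j else 0.
have E (j : 'I_M) : gridcell k j == gridcell k i ->
   \sum_t (modproj t j - cexp gridcell k (modproj t) j) ^+ 2 =
   \sum_s normc (grid_proj (offblock k s) g j) ^+ 2.
  move=> ji; rewrite -(pair_bigA _ (fun s c =>
    (modproj (s, c) j - cexp gridcell k (modproj (s, c)) j) ^+ 2)) /=.
  apply: eq_bigr => s _; rewrite modproj_sub_cexp// /g.
  by rewrite (@grid_proj_local _ _ ps2 _ k _ h Q)//; exact: offblock_saturated.
rewrite (eq_bigr _ E).
have disj' s t n : offblock k s n -> offblock k t n -> s = t.
  by move=> /andP[As _] /andP[At _]; exact: disj As At.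
have := grid_bessel ps2 g disj'.
rewrite [X in _ <= X -> _](_ : _ =
   \sum_(j | gridcell k j == gridcell k i) normc (h j) ^+ 2); last first.
  rewrite [RHS]big_mkcond; apply: eq_bigr => j _; rewrite /g /Q.
  by case: ifP => // _; rewrite normc0 expr0n.
apply: le_trans; rewrite [leLHS]big_mkcond; apply: ler_sum => j _.
by case: ifP => // _; exact: sum_sqr_ge0.
Qed.

Lemma modproj_total (i : 'I_M) :
  \sum_(j | gridcell 0 j == gridcell 0 i) \sum_t modproj t j ^+ 2 <=
  \sum_(j | gridcell 0 j == gridcell 0 i) normc (h j) ^+ 2.
Proof.
have E (j : 'I_M) : (gridcell 0 j == gridcell 0 i) = true.
  by rewrite /gridcell !cell0 ?gridpt01.
rewrite !(eq_bigl _ _ E); apply: le_trans (grid_bessel ps2 h disj).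
apply: ler_sum => j _.
rewrite -(pair_bigA _ (fun s c => modproj (s, c) j ^+ 2)) /=.
by apply: ler_sum => s _; rewrite modproj_sq.
Qed.

End one_family.

End square_function.

(** After modulation by the character of the base point [b s] the projection
  onto [A s] becomes a martingale for the filtration of the cells, and what
  remains of it after step [k] is the modulated projection onto the part of
  [A s] outside the block of length [vil_m ps k] around [b s].  That part is a
  union of such blocks, so its projection acts cell by cell, and Bessel's
  inequality holds on each cell for the whole family. *)
Lemma grid_square_function (R : realType) (q : R) (B : nat) : 2 <= q ->
  exists2 K : R, 0 < K &
  forall (ps : nat -> nat) (N : nat) (S : finType) (A : S -> pred nat)
    (b : S -> nat) (h : 'I_(vil_m ps N) -> R[i]),
  (forall i, (0 < i)%N -> (2 <= ps i)%N) ->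
  (forall i, (0 < i)%N -> (ps i <= B)%N) ->
  (forall s t n, A s n -> A t n -> s = t) ->
  (forall s, (b s < vil_m ps N)%N) ->
  (forall k s n n', (k <= N)%N -> (n %/ vil_m ps k = n' %/ vil_m ps k)%N ->
     (n %/ vil_m ps k != b s %/ vil_m ps k)%N -> A s n = A s n') ->
  \sum_i (\sum_s normc (grid_proj (A s) h i) ^+ 2) `^ (q / 2) <=
  K * \sum_i normc (h i) `^ q.
Proof.
move=> q2; have B1 : 1 <= B.+1%:R :> R by rewrite ler1n.
have [K K0 HK] := local_energy_bound q2 B1; exists K => //.
move=> ps N S A b h ps2 psB disj bM sat.
have psB' i : (0 < i)%N -> (ps i <= B.+1)%N by move=> /psB /leqW.
have := @HK _ (S * bool)%type (@gridcell R ps N) N (modproj A b h)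
   (fun i => normc (h i) ^+ 2).
have sqE i : (normc (h i) ^+ 2) `^ (q / 2) = normc (h i) `^ q.
  by rewrite powR_sq// normc_ge0.
rewrite (eq_bigr _ (fun i _ => sqE i)) => H.
rewrite (eq_bigr (fun i => (\sum_t modproj A b h t i ^+ 2) `^ (q / 2))).
  apply: H.
  - by move=> k x y kN; exact: (gridcell_coarse ps2).
  - by move=> k x kN; exact: gridcell_regular.
  - exact: gridcell_inj.
  - by move=> x; exact: sqr_ge0.
  - by move=> k x kN; exact: modproj_tail.
  - exact: modproj_total.
move=> i _; congr (_ `^ _).
rewrite -(pair_bigA _ (fun s c => modproj A b h (s, c) i ^+ 2)) /=.
by apply: eq_bigr => s _; rewrite modproj_sq.
Qed.

(** The cut [c] is the end of the largest block that contains the left end of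
  the interval but not the right one.  At the level of this block and below it
  is a block boundary; at higher levels the whole interval lies in the block
  of its endpoints, and nothing of either half is left outside.  A single
  point is its own left half. *)
Lemma interval_split (ps : nat -> nat) (lo hi : nat) :
  (forall i, (0 < i)%N -> (2 <= ps i)%N) -> (lo <= hi)%N ->
  exists c : nat, [/\ (lo < c <= hi.+1)%N,
   forall k n n', (n %/ vil_m ps k = n' %/ vil_m ps k)%N ->
     (n %/ vil_m ps k != lo %/ vil_m ps k)%N ->
     (lo <= n < c)%N = (lo <= n' < c)%N &
   forall k n n', (n %/ vil_m ps k = n' %/ vil_m ps k)%N ->
     (n %/ vil_m ps k != hi %/ vil_m ps k)%N ->
     (c <= n <= hi)%N = (c <= n' <= hi)%N].
Proof.
move=> ps2; have m0 k : (0 < vil_m ps k)%N by exact: vil_m_gt0.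
rewrite leq_eqVlt => /predU1P[->|lohi].
  exists hi.+1; split=> [|k n n' e ne|k n n' e ne]; first by rewrite !leqnn.
    have F x : (x %/ vil_m ps k != hi %/ vil_m ps k)%N -> (hi <= x < hi.+1)%N = false.
      by rewrite ltnS -eqn_leq eq_sym; apply: contraNF => /eqP ->.
    by rewrite !F// -e.
  have F x : (hi < x <= hi)%N = false by rewrite ltnNge andNb.
  by rewrite !F.
pose P k := (lo %/ vil_m ps k != hi %/ vil_m ps k)%N.
have P0 : exists k, P k.
  by exists 0%N; rewrite /P /vil_m big_geq// !divn1 neq_ltn lohi.
have Pb k : P k -> (k <= hi)%N.
  rewrite /P; apply: contraNT; rewrite -ltnNge => hk.
  have him : (hi < vil_m ps k)%N.
    by rewrite (ltn_trans hk)// (leq_trans (ltn_expl k (ltnSn 1)))// vil_m_exp.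
  by rewrite !divn_small// (ltn_trans lohi).
case: (ex_maxnP P0 Pb) => l Pl lmax.
have big_same k : (l < k)%N -> (lo %/ vil_m ps k = hi %/ vil_m ps k)%N.
  by move=> lk; apply/eqP; apply: contraTT lk => /lmax; rewrite -leqNgt.
have lt_l : (lo %/ vil_m ps l < hi %/ vil_m ps l)%N.
  by rewrite ltn_neqAle leq_div2r ?andbT// ltnW.
pose c := ((lo %/ vil_m ps l).+1 * vil_m ps l)%N.
have cl : (c <= hi)%N by rewrite -leq_divRL.
have lc : (lo < c)%N by exact: ltn_ceil.
have small k : (k <= l)%N -> exists c', c = (c' * vil_m ps k)%N.
  move=> kl; have /dvdnP[d dE] := vil_m_dvd ps kl.
  by exists ((lo %/ vil_m ps l).+1 * d)%N; rewrite /c dE mulnA.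
have lt_div k x y : (x %/ vil_m ps k != y %/ vil_m ps k)%N ->
    (x <= y)%N = (x %/ vil_m ps k < y %/ vil_m ps k)%N.
  move=> ne; apply/idP/idP => [xy|].
    by rewrite ltn_neqAle ne leq_div2r.
  by apply: contraTT; rewrite -ltnNge -leqNgt => yx; rewrite leq_div2r// ltnW.
have within k x : (l < k)%N -> (lo <= x <= hi)%N ->
    (x %/ vil_m ps k = lo %/ vil_m ps k)%N.
  move=> lk /andP[lx xh]; apply/eqP; rewrite eqn_leq [X in _ && X]leq_div2r// andbT.
  by rewrite (big_same _ lk) leq_div2r.
exists c; split.
- by rewrite lc ltnW.
- move=> k n n' e ne; have ne' : (n' %/ vil_m ps k != lo %/ vil_m ps k)%N.
    by rewrite -e.
  have [kl|lk] := leqP k l.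
    have [c' ->] := small k kl; rewrite -!ltn_divLR//.
    by rewrite !(lt_div k lo) 1?eq_sym// e.
  have F x : (x %/ vil_m ps k != lo %/ vil_m ps k)%N -> (lo <= x < c)%N = false.
    move=> nx; apply: contraNF nx => /andP[lx xc]; apply/eqP; apply: within => //.
    by rewrite lx (leq_trans (ltnW xc)).
  by rewrite !F.
- move=> k n n' e ne; have ne' : (n' %/ vil_m ps k != hi %/ vil_m ps k)%N.
    by rewrite -e.
  have [kl|lk] := leqP k l.
    have [c' ->] := small k kl; rewrite -!leq_divRL//.
    by rewrite !(lt_div k _ hi)// e.
  have F x : (x %/ vil_m ps k != hi %/ vil_m ps k)%N -> (c <= x <= hi)%N = false.
    move=> nx; apply: contraNF nx => /andP[cx xh]; rewrite -big_same//.
    by apply/eqP; apply: within => //; rewrite xh (leq_trans (ltnW lc)).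
  by rewrite !F.
Qed.

(** * Duality *)

Lemma grid_proj_pairing (R : realType) (ps : nat -> nat) N (A : pred nat)
    (f g : 'I_(vil_m ps N) -> R[i]) :
  (forall i, (0 < i)%N -> (2 <= ps i)%N) ->
  \sum_i grid_proj A f i * (g i)^*%C =
  (vil_m ps N)%:R * \sum_(n < vil_m ps N | A n) grid_coef f n * (grid_coef g n)^*%C.
Proof.
move=> ps2; have M0 : (vil_m ps N)%:R != 0 :> R[i].
  by rewrite pnatr_eq0 -lt0n vil_m_gt0.
rewrite /grid_proj; under eq_bigr => i _ do rewrite mulr_suml.
rewrite exchange_big mulr_sumr; apply: eq_bigr => n _ /=.
under eq_bigr => i _ do rewrite -mulrA.
rewrite -mulr_sumr mulrCA; congr (_ * _).
rewrite [in RHS]/grid_coef conjcM conjc_inv conjc_nat mulrA mulfV// mul1r.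
rewrite rmorph_sum; apply: eq_bigr => i _ /=.
by rewrite -/(conjc _) -/(conjc (g i * _)) conjcM conjcK mulrC.
Qed.

Lemma grid_proj_pairing_r (R : realType) (ps : nat -> nat) N (A : pred nat)
    (f g : 'I_(vil_m ps N) -> R[i]) :
  (forall i, (0 < i)%N -> (2 <= ps i)%N) ->
  \sum_i f i * (grid_proj A g i)^*%C =
  (vil_m ps N)%:R * \sum_(n < vil_m ps N | A n) grid_coef f n * (grid_coef g n)^*%C.
Proof.
move=> ps2; apply: (can_inj (@conjcK R)).
rewrite conjcM conjc_nat !rmorph_sum /=.
rewrite (eq_bigr (fun i => grid_proj A g i * (f i)^*%C)); last first.
  by move=> i _; rewrite conjcM conjcK mulrC.
rewrite grid_proj_pairing//; congr (_ * _); apply: eq_bigr => n _.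
by rewrite [RHS]conjcM conjcK mulrC.
Qed.

Lemma Re_pairing_le (R : realType) (I T : finType) (f g : I -> T -> R[i]) :
  complex.Re (\sum_s \sum_i f s i * (g s i)^*%C) <=
  \sum_i Num.sqrt (\sum_s normc (g s i) ^+ 2) *
         Num.sqrt (\sum_s normc (f s i) ^+ 2).
Proof.
rewrite exchange_big Re_sum; apply: ler_sum => i _.
rewrite Re_sum mulrC; apply: le_trans (cauchy_schwarz_sum _ _).
apply: ler_sum => s _; apply: le_trans (Re_le_normc _) _.
by rewrite normcM normc_conj.
Qed.

(** The inequality for functions on a grid, by duality: testing the sum [F]
  against [F] times a power of its modulus and inserting the projections onto
  the two halves of each interval leaves the square functions of the dual
  inequality, which are absorbed. *)
Lemma grid_interval_inequality (R : realType) (p : R) (B : nat) :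
  1 < p -> p <= 2 ->
  exists2 C : R, 0 < C &
  forall (ps : nat -> nat) (N : nat) (S : finType) (lo hi : S -> nat)
    (f : S -> 'I_(vil_m ps N) -> R[i]),
  (forall i, (0 < i)%N -> (2 <= ps i)%N) ->
  (forall i, (0 < i)%N -> (ps i <= B)%N) ->
  (forall s, (lo s <= hi s < vil_m ps N)%N) ->
  (forall s t n, (lo s <= n <= hi s)%N -> (lo t <= n <= hi t)%N -> s = t) ->
  (forall s i, grid_proj (fun n => lo s <= n <= hi s)%N (f s) i = f s i) ->
  \sum_i normc (\sum_s f s i) `^ p <=
  C * \sum_i (\sum_s normc (f s i) ^+ 2) `^ (p / 2).
Proof.
move=> p1 p2; pose q := p / (p - 1).
have p10 : 0 < p - 1 by lra.
have q2 : 2 <= q by rewrite /q ler_pdivlMr//; lra.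
have q10 : 0 < q - 1 by lra.
have [K K0 HK] := @grid_square_function R q B q2.
(* Small enough for both dual square functions to be absorbed. *)
pose d := (4 * K)^-1; have d0 : 0 < d by rewrite invr_gt0 mulr_gt0.
pose c := d `^ (- (1 / (q - 1))); have c0 : 0 < c by exact: powR_gt0.
exists (4 * c); first by rewrite mulr_gt0.
move=> ps N S lo hi f ps2 psB lohi disj fproj.
have lohi_le s : (lo s <= hi s)%N by have /andP[] := lohi s.
have [cut cutP] := boolp.choice (fun s => interval_split ps2 (lohi_le s)).
pose L s : pred nat := fun n => (lo s <= n < cut s)%N.
pose U s : pred nat := fun n => (cut s <= n <= hi s)%N.
have LI s n : L s n -> (lo s <= n <= hi s)%N.
  have [/andP[_ ch] _ _] := cutP s.
  by rewrite /L => /andP[-> nc]; rewrite -ltnS (leq_trans nc).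
have UI s n : U s n -> (lo s <= n <= hi s)%N.
  have [/andP[lc _] _ _] := cutP s.
  by rewrite /U => /andP[cn ->]; rewrite andbT ltnW// (leq_trans lc).
pose F i := \sum_s f s i.
pose h i := ((normc (F i) `^ (p - 2))%:C)%C * F i.
have hF i : F i * (h i)^*%C = ((normc (F i) `^ p)%:C)%C.
  rewrite /h conjcM conjc_real mulrCA mulcJ -rmorphM /=; congr (_%:C)%C.
  have [->|n0] := eqVneq (normc (F i)) 0.
    by rewrite expr0n mulr0 powR0// gt_eqF//; lra.
  rewrite -powR_mulrn ?normc_ge0// -powRD; first by congr powR; ring.
  by rewrite n0 implybT.
have hq i : normc (h i) `^ q = normc (F i) `^ p.
  rewrite /h normcM /= expr0n addr0 sqrtr_sqr ger0_norm ?powR_ge0//.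
  have -> : normc (F i) `^ (p - 2) * normc (F i) = normc (F i) `^ (p - 1).
    have [->|n0] := eqVneq (normc (F i)) 0.
      by rewrite mulr0 powR0// gt_eqF.
    rewrite -{2}[normc (F i)]powRr1 ?normc_ge0// -powRD; first by congr powR; ring.
    by rewrite n0 implybT.
  by rewrite -powRrM /q mulrCA mulfV ?mulr1// gt_eqF.
have split s : \sum_i f s i * (h i)^*%C =
    \sum_i f s i * (grid_proj (L s) h i)^*%C + \sum_i f s i * (grid_proj (U s) h i)^*%C.
  under eq_bigr => i _ do rewrite -fproj.
  rewrite grid_proj_pairing// !grid_proj_pairing_r// -mulrDr; congr (_ * _).
  rewrite (bigID (fun n : 'I_(vil_m ps N) => n < cut s)%N) /=.
  have [/andP[lc ch] _ _] := cutP s.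
  congr (_ + _); apply: eq_bigl => n; apply/idP/idP.
  - by move=> /andP[/andP[a b] e]; rewrite /L a e.
  - by move=> Ln; rewrite LI//=; move: Ln => /andP[].
  - by rewrite -leqNgt => /andP[/andP[a b] e]; rewrite /U e b.
  - by move=> Un; rewrite UI//= -leqNgt; move: Un => /andP[].
pose SL i := Num.sqrt (\sum_s normc (grid_proj (L s) h i) ^+ 2).
pose SU i := Num.sqrt (\sum_s normc (grid_proj (U s) h i) ^+ 2).
pose Sf i := Num.sqrt (\sum_s normc (f s i) ^+ 2).
have sqrt_pow (u : S -> R) r :
    Num.sqrt (\sum_s u s ^+ 2) `^ r = (\sum_s u s ^+ 2) `^ (r / 2).
  by rewrite -[LHS]powR_sq ?sqrtr_ge0// sqr_sqrtr// sum_sqr_ge0.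
have main : \sum_i normc (F i) `^ p <= \sum_i SL i * Sf i + \sum_i SU i * Sf i.
  have -> : \sum_i normc (F i) `^ p =
     complex.Re (\sum_s \sum_i f s i * (grid_proj (L s) h i)^*%C) +
     complex.Re (\sum_s \sum_i f s i * (grid_proj (U s) h i)^*%C).
    rewrite -ReD -big_split /= -(eq_bigr _ (fun s _ => split s)) exchange_big /=.
    rewrite Re_sum; apply: eq_bigr => i _.
    by rewrite -mulr_suml -/(F i) hF.
  by apply: lerD; exact: Re_pairing_le.
have young (G : 'I_(vil_m ps N) -> R) : (forall i, 0 <= G i) ->
    \sum_i G i * Sf i <= d * (\sum_i G i `^ q) + c * \sum_i Sf i `^ p.
  move=> G0; rewrite !mulr_sumr -big_split; apply: ler_sum => i _ /=.
  have := @powR_young R 1 (q - 1) d (G i) (Sf i) ler01 q10 d0 (G0 i) (sqrtr_ge0 _).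
  rewrite powRr1// [1 + _]addrC subrK -/c.
  suff -> : q / (q - 1) = p by [].
  by rewrite /q; field; rewrite !gt_eqF//; lra.
have bound (A : S -> pred nat) (b : S -> nat) :
    (forall s n, A s n -> (lo s <= n <= hi s)%N) ->
    (forall s, (b s < vil_m ps N)%N) ->
    (forall s k n n', (n %/ vil_m ps k = n' %/ vil_m ps k)%N ->
     (n %/ vil_m ps k != b s %/ vil_m ps k)%N -> A s n = A s n') ->
    \sum_i Num.sqrt (\sum_s normc (grid_proj (A s) h i) ^+ 2) `^ q <=
    K * \sum_i normc (F i) `^ p.
  move=> AI bM sat; under eq_bigr do rewrite sqrt_pow.
  under [in leRHS]eq_bigr do rewrite -hq.
  apply: (@HK ps N S A b) => //.
    by move=> s t n As At; apply: (disj s t n); exact: AI.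
  by move=> k s n n' _; exact: sat.
have bL : \sum_i SL i `^ q <= K * \sum_i normc (F i) `^ p.
  apply: (bound L lo) => //.
    by move=> s; have /andP[] := lohi s; exact: leq_ltn_trans.
  by move=> s; have [] := cutP s.
have bU : \sum_i SU i `^ q <= K * \sum_i normc (F i) `^ p.
  apply: (bound U hi) => //.
    by move=> s; have /andP[] := lohi s.
  by move=> s; have [] := cutP s.
have yL := young SL (fun i => sqrtr_ge0 _).
have yU := young SU (fun i => sqrtr_ge0 _).
have -> : \sum_i (\sum_s normc (f s i) ^+ 2) `^ (p / 2) = \sum_i Sf i `^ p.
  by apply: eq_bigr => i _; rewrite sqrt_pow.
rewrite -[leLHS]/(\sum_i normc (F i) `^ p).
have dK : d * K = 4^-1 by rewrite /d; field; rewrite gt_eqF.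
have bL' := ler_wpM2l (ltW d0) bL; have bU' := ler_wpM2l (ltW d0) bU.
rewrite !mulrA !dK in bL' bU'.
have absorb (X A1 A2 B1 B2 Y : R) : X <= A1 + A2 -> A1 <= B1 + c * Y ->
    A2 <= B2 + c * Y -> B1 <= 4^-1 * X -> B2 <= 4^-1 * X -> X <= 4 * c * Y.
  by lra.
exact: absorb main yL yU bL' bU'.
Qed.

(** * Vilenkin-Fourier series of integrable functions *)

Section complex_measurability.
Context {R : realType}.
Implicit Types (D : set R) (f g : R -> R[i]).

Definition cmeasurable D f := measurable_fun D (fun x => complex.Re (f x)) /\
  measurable_fun D (fun x => complex.Im (f x)).

Lemma ReJ (z : R[i]) : complex.Re z^*%C = complex.Re z.
Proof. by case: z. Qed.

Lemma ImJ (z : R[i]) : complex.Im z^*%C = - complex.Im z.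
Proof. by case: z. Qed.

Lemma cmeasurable_cst D (c : R[i]) : cmeasurable D (fun=> c).
Proof. by split; exact: measurable_cst. Qed.

Lemma cmeasurableM D f g : cmeasurable D f -> cmeasurable D g ->
  cmeasurable D (fun x => f x * g x).
Proof.
move=> [fr fi] [gr gi]; split.
  under eq_fun do rewrite ReM.
  by apply: measurable_funB; exact: measurable_funM.
under eq_fun do rewrite ImM.
by apply: measurable_funD; exact: measurable_funM.
Qed.

Lemma cmeasurableX D f n : cmeasurable D f -> cmeasurable D (fun x => f x ^+ n).
Proof.
move=> mf; elim: n => [|n IH].
  by under eq_fun do rewrite expr0; exact: cmeasurable_cst.
by under eq_fun do rewrite exprS; exact: cmeasurableM.
Qed.

Lemma cmeasurable_prod D (I : Type) (s : seq I) (F : I -> R -> R[i]) :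
  (forall i, cmeasurable D (F i)) ->
  cmeasurable D (fun x => \prod_(i <- s) F i x).
Proof.
move=> mF; elim: s => [|i s IH].
  by under eq_fun do rewrite big_nil; exact: cmeasurable_cst.
by under eq_fun do rewrite big_cons; exact: cmeasurableM.
Qed.

Lemma cmeasurable_sum D (I : Type) (s : seq I) (F : I -> R -> R[i]) :
  (forall i, cmeasurable D (F i)) ->
  cmeasurable D (fun x => \sum_(i <- s) F i x).
Proof.
move=> mF; split.
  by under eq_fun do rewrite Re_sum; apply: measurable_sum => i; case: (mF i).
by under eq_fun do rewrite Im_sum; apply: measurable_sum => i; case: (mF i).
Qed.

Lemma cmeasurable_normc D f : cmeasurable D f ->
  measurable_fun D (fun x => normc (f x)).
Proof.
move=> [fr fi].
have -> : (fun x => normc (f x)) = (fun x =>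
    (complex.Re (f x) ^+ 2 + complex.Im (f x) ^+ 2) `^ 2^-1).
  apply/funext => x; rewrite powR12_sqrt ?addr_ge0 ?sqr_ge0//.
  by case: (f x).
apply: (measurableT_comp (measurable_powR _)).
by apply: measurable_funD; exact: measurable_funX.
Qed.

Lemma cmeasurable_cexpi D (t : R -> R) : measurable_fun D t ->
  cmeasurable D (fun x => cexpi (t x)).
Proof.
move=> mt; split => /=; apply: measurableT_comp mt.
  exact: continuous_measurable_fun (@continuous_cos R).
exact: continuous_measurable_fun (@continuous_sin R).
Qed.

Lemma cmeasurable_rademacher D ps k : measurable D ->
  cmeasurable D (@vil_rademacher R ps k).
Proof.
move=> mD; apply: cmeasurable_cexpi.
apply: measurable_funM => //; apply: measurable_funM => //.
apply: nondecreasing_measurable => // x y xy.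
by rewrite ler_int; apply: le_floor; rewrite ler_wpM2l.
Qed.

Lemma cmeasurable_vil_w D ps n : measurable D -> cmeasurable D (@vil_w R ps n).
Proof.
move=> mD; apply: cmeasurable_prod => k; apply: cmeasurableX.
exact: cmeasurable_rademacher.
Qed.

End complex_measurability.

Section fourier.
Context {R : realType}.
Local Notation mu := (@lebesgue_measure R).
Local Notation I01 := (unit_itv R).

Lemma ae_imply (P Q : R -> Prop) : (forall x, P x -> Q x) ->
  {ae mu, forall x, P x} -> {ae mu, forall x, Q x}.
Proof. by move=> PQ; apply: filterS PQ; exact: (ae_filter_ringOfSetsType mu). Qed.

Lemma ae_imply2 (P P' Q : R -> Prop) : (forall x, P x -> P' x -> Q x) ->
  {ae mu, forall x, P x} -> {ae mu, forall x, P' x} -> {ae mu, forall x, Q x}.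
Proof.
by move=> PQ; apply: filterS2 PQ; exact: (ae_filter_ringOfSetsType mu).
Qed.

Lemma measurable_unit_itv : measurable I01.
Proof. exact: measurable_itv. Qed.
Hint Resolve measurable_unit_itv : core.

Lemma unit_itv_half x : 0 <= x < 1 -> I01 x.
Proof. by move=> /andP[x0 x1]; rewrite /unit_itv /= in_itv /= x0 ltW. Qed.

Lemma abs_Re_le_normc (z : R[i]) : `|complex.Re z| <= normc z.
Proof.
rewrite ler_norml Re_le_normc andbT lerNl.
by have := Re_le_normc (- z); rewrite normcN; case: z.
Qed.

Lemma abs_Im_le_normc (z : R[i]) : `|complex.Im z| <= normc z.
Proof.
rewrite -(@ler_pXn2r _ 2)// ?nnegrE ?normc_ge0//.
by rewrite real_normK ?num_real// normc_sq lerDr sqr_ge0.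
Qed.

Lemma cintegrableM_bounded (f g : R -> R[i]) : cintegrable01 f ->
  cmeasurable I01 g -> (forall x, normc (g x) <= 1) ->
  cintegrable01 (fun x => f x * g x).
Proof.
move=> [fr fi] [gr gi] g1.
have bnd (u : R[i] -> R) : (forall z, `|u z| <= normc z) ->
    [bounded u (g x) | x in I01].
  move=> ub; exists 1; split; first exact: num_real.
  by move=> y y1 x _ /=; rewrite (le_trans (ub _))// (le_trans (g1 _))// ltW.
have bR := bnd _ abs_Re_le_normc; have bI := bnd _ abs_Im_le_normc.
split.
  under eq_fun do rewrite ReM EFinB 2!EFinM.
  by apply: integrableB => //; apply: integrableMl.
under eq_fun do rewrite ImM EFinD 2!EFinM.
by apply: integrableD => //; apply: integrableMl.
Qed.

Lemma cintegrableZ (c : R[i]) (f : R -> R[i]) : cintegrable01 f ->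
  cintegrable01 (fun x => c * f x).
Proof.
move=> [fr fi]; split.
  under eq_fun do rewrite ReM EFinB 2!EFinM.
  by apply: integrableB => //; apply: integrableZl.
under eq_fun do rewrite ImM EFinD 2!EFinM.
by apply: integrableD => //; apply: integrableZl.
Qed.

Lemma cintegral01Z (c : R[i]) (f : R -> R[i]) : cintegrable01 f ->
  cintegral01 (fun x => c * f x) = c * cintegral01 f.
Proof.
move=> [fr fi]; rewrite /cintegral01; apply/eqP; rewrite eq_complex ReM ImM /=.
have irr (a : R) (h : R -> R) : mu.-integrable I01 (EFin \o h) ->
    mu.-integrable I01 (EFin \o (fun x => a * h x)).
  move=> ih; have := @integrableZl _ _ R mu I01 measurable_unit_itv a _ ih.
  by apply: eq_integrable.
apply/andP; split; apply/eqP.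
  under eq_Rintegral do rewrite ReM -mulNr.
  rewrite RintegralD//; [|exact: irr..].
  by rewrite !RintegralZl// mulNr.
under eq_Rintegral do rewrite ImM.
rewrite RintegralD//; [|exact: irr..].
by rewrite !RintegralZl.
Qed.

Lemma cintegral01_sum (T : Type) (s : seq T) (F : T -> R -> R[i]) :
  (forall i, cintegrable01 (F i)) ->
  cintegral01 (fun x => \sum_(i <- s) F i x) = \sum_(i <- s) cintegral01 (F i).
Proof.
move=> iF.
have ireal (u : R[i] -> R) : (forall i, mu.-integrable I01 (fun x => (u (F i x))%:E)) ->
    forall r : seq T, mu.-integrable I01
      (EFin \o (fun x => \sum_(i <- r) u (F i x))).
  move=> iu r; have := @integrable_sum _ _ R mu I01 measurable_unit_itv T r xpredT
     (fun i x => (u (F i x))%:E) (fun i _ => iu i).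
  by apply: eq_integrable => // x _ /=; rewrite sumEFin.
have sreal (u : R[i] -> R) : (forall i, mu.-integrable I01 (fun x => (u (F i x))%:E)) ->
    (\int[mu]_(x in I01) (\sum_(i <- s) u (F i x)) =
    \sum_(i <- s) \int[mu]_(x in I01) u (F i x))%R.
  move=> iu; elim: s => [|i r IH].
    under eq_Rintegral do rewrite big_nil.
    by rewrite big_nil Rintegral_cst// mul0r.
  under eq_Rintegral do rewrite big_cons.
  by rewrite RintegralD//; [rewrite big_cons IH|exact: iu|exact: ireal].
apply/eqP; rewrite eq_complex Re_sum Im_sum /=; apply/andP; split; apply/eqP.
  by under eq_Rintegral do rewrite Re_sum; apply: sreal => i; case: (iF i).
by under eq_Rintegral do rewrite Im_sum; apply: sreal => i; case: (iF i).
Qed.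

Section expansion.
Variable ps : nat -> nat.
Hypothesis ps2 : forall i, (0 < i)%N -> (2 <= ps i)%N.
Local Notation m := (vil_m ps).

Let mR_gt0 k : 0 < (m k)%:R :> R. Proof. by rewrite ltr0n vil_m_gt0. Qed.

(** Cells around all points of the line, since the differentiation theorem asks
  for sets that shrink to every point. *)
Definition cellset k (x : R) : set R :=
  `[(Num.floor ((m k)%:R * x))%:~R / (m k)%:R,
    ((Num.floor ((m k)%:R * x))%:~R + 1) / (m k)%:R[%classic.

Lemma cellsetP k x y :
  cellset k x y <-> Num.floor ((m k)%:R * y) = Num.floor ((m k)%:R * x).
Proof.
rewrite /cellset /= in_itv /= ler_pdivrMr// ltr_pdivlMr// -intrD1 ![_ * (m k)%:R]mulrC.
split=> [/floor_def//|<-].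
by apply/andP; split; rewrite ?floor_le_tmp ?floorD1_gt// ge_floor.
Qed.

Lemma mu_cellset k x : mu (cellset k x) = ((m k)%:R^-1)%:E.
Proof.
rewrite /cellset lebesgue_measure_itv /= lte_fin ltr_pM2r ?invr_gt0// ltrDl ltr01.
by rewrite -EFinB -mulrBl addrAC subrr add0r mul1r.
Qed.

Lemma cellset_01 k x y : 0 <= x < 1 -> cellset k x y -> 0 <= y < 1.
Proof.
move=> /andP[x0 x1] /cellsetP e.
have y0 : 0 <= (m k)%:R * y.
  by rewrite -floor_ge0 e floor_ge0 mulr_ge0.
have y1 : (m k)%:R * y < (m k)%:R.
  have -> : (m k)%:R = (m k : int)%:~R :> R by [].
  rewrite -floor_lt_int e floor_lt_int.
  by rewrite -[ltRHS]mulr1 ltr_pM2l.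
by rewrite -(pmulr_rge0 _ (mR_gt0 k)) y0 -(ltr_pM2l (mR_gt0 k)) mulr1.
Qed.

Lemma cellset_cell k x y : 0 <= x -> 0 <= y ->
  cellset k x y <-> cell ps k y = cell ps k x.
Proof.
move=> x0 y0; rewrite /cell !truncn_floor !mulr_ge0//.
have fx : 0 <= Num.floor ((m k)%:R * x) by rewrite floor_ge0 mulr_ge0.
have fy : 0 <= Num.floor ((m k)%:R * y) by rewrite floor_ge0 mulr_ge0.
split=> [/cellsetP -> //|e]; apply/cellsetP.
by move: fx fy e; case: Num.floor => // a; case: Num.floor => // b _ _ /= ->.
Qed.

Lemma vil_m_cvg : (m k)%:R^-1 @[k --> \oo] --> (0 : R).
Proof.
apply: (@squeeze_cvgr _ _ _ _ (fun=> 0) (fun k => k.+1%:R^-1)).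
- near=> k; apply/andP; split; first by rewrite invr_ge0.
  rewrite lef_pV2 ?posrE// ler_nat.
  by rewrite (leq_trans _ (vil_m_exp k ps2))// ltn_expl.
- exact: cvg_cst.
- exact: cvg_harmonic.
Unshelve. all: by end_near. Qed.

Lemma cellset_nicely_shrinking x : nicely_shrinking x (cellset ^~ x).
Proof.
split; first by move=> k; exact: measurable_itv.
have r0 k : 0 < (m k)%:R^-1 :> R by rewrite invr_gt0.
exists (2, fun k => PosNum (r0 k)); split => //=.
- exact: vil_m_cvg.
- move=> k y /cellsetP e; rewrite /ball /=.
  have /andP[a b] := floor_itv ((m k)%:R * x).
  have /andP[c d] := floor_itv ((m k)%:R * y).
  rewrite e in c d; rewrite -(ltr_pM2l (mR_gt0 k)) mulfV ?gt_eqF//.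
  rewrite -{1}(gtr0_norm (mR_gt0 k)) -normrM mulrBr ltr_norml.
  rewrite intrD1 in b d; apply/andP; split; lra.
- move=> k; rewrite mu_cellset lebesgue_measure_ball ?(ltW (r0 k))//.
  by rewrite -EFinM mulr_natl.
Qed.

(** Paley's lemma integrated against [f].  The endpoint [1] is dropped from the
  domain because the kernel identity does not cover it. *)
Lemma partial_sum_average (f : R -> R[i]) k x : 0 <= x < 1 -> cintegrable01 f ->
  \sum_(n < m k) vil_coef ps f n * vil_w ps n x =
  ((m k)%:R * (\int[mu]_(y in cellset k x) complex.Re (f y))%R +i*
   ((m k)%:R * (\int[mu]_(y in cellset k x) complex.Im (f y))%R))%C.
Proof.
move=> x01 ifn; have [x0 x1] := andP x01.
have iw n : cintegrable01 (fun y => f y * (vil_w ps n y)^*%C).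
  apply: cintegrableM_bounded => //.
    have [a b] := cmeasurable_vil_w ps n measurable_unit_itv.
    split; first by under eq_fun do rewrite ReJ.
    under eq_fun do rewrite ImJ.
    exact: measurableT_comp.
  by move=> y; rewrite normc_conj vil_w_norm.
have -> : \sum_(n < m k) vil_coef ps f n * vil_w ps n x = cintegral01 (fun y =>
    \sum_(n < m k) vil_w ps n x * (f y * (vil_w ps n y)^*%C)).
  rewrite (@cintegral01_sum _ _ (fun (n : 'I_(m k)) y =>
    vil_w ps n x * (f y * (vil_w ps n y)^*%C))); last first.
    by move=> n; exact: cintegrableZ.
  by apply: eq_bigr => n _; rewrite cintegral01Z// mulrC.
have K (u : R[i] -> R) : (forall n z, u (n%:R * z) = n%:R * u z) ->
   mu.-integrable I01 (fun y => (u (f y))%:E) ->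
   mu.-integrable I01 (fun y =>
      (u (\sum_(n < m k) vil_w ps n x * (f y * (vil_w ps n y)^*%C)))%:E) ->
   (\int[mu]_(y in I01) (u (\sum_(n < m k) vil_w ps n x * (f y * (vil_w ps n y)^*%C))) =
   (m k)%:R * \int[mu]_(y in cellset k x) u (f y))%R.
  move=> uM iu isum.
  have sub1 : `[0, 1[%classic `<=` I01.
    by move=> y /=; rewrite in_itv /=; exact: unit_itv_half.
  have cs : cellset k x `<=` I01.
    by move=> y /(cellset_01 x01); exact: unit_itv_half.
  rewrite /unit_itv -Rintegral_itv_bndo_bndc; last first.
    by apply: (integrableS _ _ _ isum) => //; exact: measurable_itv.
  rewrite -RintegralZl//; [|exact: measurable_itv|]; last first.
    by apply: (integrableS _ _ _ iu) => //; exact: measurable_itv.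
  have -> : cellset k x = `[0, 1[%classic `&` cellset k x.
    rewrite setIidr// => y /(cellset_01 x01) y01; by rewrite /= in_itv.
  rewrite Rintegral_mkcondr; apply: eq_Rintegral => y.
  rewrite inE /= in_itv /= => y01; have [y0 _] := andP y01.
  have -> : \sum_(n < m k) vil_w ps n x * (f y * (vil_w ps n y)^*%C) =
    (\sum_(n < m k) vil_w ps n x * (vil_w ps n y)^*%C) * f y.
    by rewrite mulr_suml; apply: eq_bigr => n _; rewrite -mulrA [f y * _]mulrC.
  rewrite dirichlet_kernel// patchE.
  have [e|ne] := eqVneq (cell ps k x) (cell ps k y).
    by rewrite uM mem_set//; apply/(cellset_cell k x0 y0).
  rewrite mul0r memNset.
    by have := uM 0%N 0; rewrite !mul0r.
  by move=> /(cellset_cell k x0 y0) e; rewrite e eqxx in ne.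
have [ir ii] := ifn.
have isum : cintegrable01 (fun y =>
    \sum_(n < m k) vil_w ps n x * (f y * (vil_w ps n y)^*%C)).
  split.
    under eq_fun do rewrite Re_sum -sumEFin.
    by apply: integrable_sum => // n _; case: (cintegrableZ (vil_w ps n x) (iw n)).
  under eq_fun do rewrite Im_sum -sumEFin.
  by apply: integrable_sum => // n _; case: (cintegrableZ (vil_w ps n x) (iw n)).
have [sr si] := isum.
rewrite /cintegral01 (K (@complex.Re R)) ?(K (@complex.Im R))//.
  exact: Im_natM.
exact: Re_natM.
Qed.

Lemma cell_average_cvg (g : R -> R) :
  mu.-integrable I01 (fun y => (g y)%:E) ->
  {ae mu, forall x, 0 <= x < 1 ->
    (m k)%:R * (\int[mu]_(y in cellset k x) g y)%R @[k --> \oo] --> g x}.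
Proof.
move=> ig; have loc := integrable_locally_restrict measurable_unit_itv ig.
have := lebesgue_differentiation loc; apply: ae_imply => x lx x01.
have x1 : I01 x by exact: unit_itv_half.
have := nice_lebesgue_differentiation cellset_nicely_shrinking loc lx.
rewrite patchE mem_set// => /fine_cvgP[_].
apply: cvg_trans; apply: near_eq_cvg; apply: nearW => k /=.
rewrite mu_cellset inver gt_eqF ?invr_gt0// invrK.
have cs : cellset k x `<=` I01.
  by move=> y /(cellset_01 x01); exact: unit_itv_half.
have ic : mu.-integrable (cellset k x) (fun y => (g y)%:E).
  by apply: (integrableS _ _ _ ig) => //; exact: measurable_itv.
under eq_integral => y yc.
  rewrite patchE mem_set; last by apply: cs; exact: set_mem.
  over.
rewrite fineM//=.
by apply: integrable_fin_num => //; exact: measurable_itv.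
Qed.

(** Uniqueness of Fourier series: an integrable function with finitely many
  frequencies is a polynomial, since its partial sums are eventually constant
  and, being averages over shrinking cells, converge to it. *)
Lemma spectral_expansion (f : R -> R[i]) b : cintegrable01 f ->
  (forall n, (b <= n)%N -> vil_coef ps f n = 0) ->
  {ae mu, forall x, 0 <= x < 1 ->
    f x = \sum_(n < b) vil_coef ps f n * vil_w ps n x}.
Proof.
move=> ifn f0; have [ir ii] := ifn.
apply: ae_imply2 (cell_average_cvg ir) (cell_average_cvg ii) => x cr ci x01.
have S k : (b <= k)%N -> \sum_(n < m k) vil_coef ps f n * vil_w ps n x =
    \sum_(n < b) vil_coef ps f n * vil_w ps n x.
  move=> bk; have bm : (b <= m k)%N.
    by rewrite (leq_trans bk)// (leq_trans (ltnW (ltn_expl k (ltnSn 1))))// vil_m_exp.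
  rewrite -!(big_mkord xpredT (fun n => vil_coef ps f n * vil_w ps n x)).
  rewrite (@big_cat_nat _ _ _ b)//= [X in _ + X]big1_seq ?addr0// => n.
  by rewrite mem_index_iota => /andP[_ /andP[bn _]]; rewrite f0// mul0r.
have lim (u : R[i] -> R) (v : nat -> R) : v k @[k --> \oo] --> u (f x) ->
   (forall k, (b <= k)%N ->
      v k = u (\sum_(n < b) vil_coef ps f n * vil_w ps n x)) ->
   u (f x) = u (\sum_(n < b) vil_coef ps f n * vil_w ps n x).
  move=> vc vE; apply/esym; apply: (@cvg_unique _ (@norm_hausdorff _ R) (v @ \oo)) => //.
  apply: cvg_near_cst; near=> k; apply: vE; near: k; exact: nbhs_infty_ge.
apply/eqP; rewrite eq_complex; apply/andP; split; apply/eqP.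
  apply: (lim (@complex.Re R) _ (cr x01)) => k bk.
  by rewrite -(S k bk) partial_sum_average.
apply: (lim (@complex.Im R) _ (ci x01)) => k bk.
by rewrite -(S k bk) partial_sum_average.
Unshelve. all: by end_near. Qed.

End expansion.

End fourier.

(** * Finite families *)

Section finite_families.
Context {R : realType}.
Local Notation mu := (@lebesgue_measure R).
Local Notation I01 := (unit_itv R).

Lemma ae_neq (a : R) : {ae mu, forall x, x != a}.
Proof.
exists [set a]; split => //; first exact: lebesgue_measure_set1.
by move=> x /= /negP; rewrite negbK => /eqP.
Qed.

Lemma cintegrable_cmeasurable (f : R -> R[i]) :
  cintegrable01 f -> cmeasurable I01 f.
Proof.
by move=> [/measurable_int/measurable_EFinP ? /measurable_int/measurable_EFinP].
Qed.

Section grid_functions.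
Variable ps : nat -> nat.
Hypothesis ps2 : forall i, (0 < i)%N -> (2 <= ps i)%N.
Variable N : nat.
Local Notation M := (vil_m ps N).

Let M_gt0 : 0 < M%:R :> R. Proof. by rewrite ltr0n vil_m_gt0. Qed.

Lemma cell_lt (x : R) : 0 <= x < 1 -> (cell ps N x < M)%N.
Proof.
move=> /andP[x0 x1]; rewrite /cell truncn_lt_nat ?mulr_ge0//.
by rewrite -[ltRHS]mulr1 ltr_pM2l.
Qed.

Lemma grid_integral (phi : R -> R) (Phi : 'I_M -> R) :
  measurable_fun I01 phi -> (forall i, 0 <= Phi i) ->
  {ae mu, forall x : R, 0 <= x < 1 ->
    forall i : 'I_M, cell ps N x = i -> phi x = Phi i} ->
  (\int[mu]_(x in I01) (phi x)%:E = (M%:R^-1 * \sum_i Phi i)%:E)%E.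
Proof.
move=> mphi Phi0 ae; pose E (i : 'I_M) := @cellset R ps N (@gridpt R ps N i).
have mE i : measurable (E i) by exact: measurable_itv.
pose s x : \bar R := (\sum_i ((Phi i)%:E * (\1_(E i) x)%:E))%E.
have mf i : measurable_fun I01 (fun x => (Phi i)%:E * (\1_(E i) x)%:E)%E.
  apply: emeasurable_funM; first exact: measurable_cst.
  by apply/measurable_EFinP; exact: measurable_indic.
have f0 i x : I01 x -> (0 <= (Phi i)%:E * (\1_(E i) x)%:E)%E.
  by move=> _; rewrite mule_ge0// lee_fin// /indic ler0n.
rewrite (@ae_eq_integral _ _ R mu I01 s).
- rewrite /s ge0_integral_sum//.
  transitivity (\sum_i (Phi i * M%:R^-1)%:E)%E; last first.
    by rewrite sumEFin -mulr_suml mulrC.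
  apply: eq_bigr => i _.
  transitivity ((Phi i)%:E * \int[mu]_(x in I01) (\1_(E i) x)%:E)%E.
    apply: ge0_integralZl => //.
    - exact: measurable_unit_itv.
    - by apply/measurable_EFinP; apply: measurable_indic; exact: mE.
    - by rewrite lee_fin.
  rewrite (integral_indic mu measurable_unit_itv (mE i)) setIidl; last first.
    move=> x /(cellset_01 ps2 (gridpt01 ps2 i)); exact: unit_itv_half.
  by rewrite EFinM; congr (_ * _)%E; exact: (mu_cellset ps2 N).
- exact: measurable_unit_itv.
- exact: measurable_unit_itv.
- by apply/measurable_EFinP; exact: mphi.
- by rewrite /s; exact: emeasurable_sum.
- apply: ae_imply2 ae (ae_neq 1) => x aex x1 Ix.
  have x01 : 0 <= x < 1.
    move: Ix; rewrite /unit_itv /= in_itv /= => /andP[-> xle].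
    by rewrite lt_neqAle x1.
  pose i := Ordinal (cell_lt x01).
  rewrite (aex x01 i erefl) /s (bigD1 i)//= big1 ?adde0.
    rewrite indicE mem_set ?mule1//.
    have /andP[x0 _] := x01; have /andP[g0 _] := @gridpt01 R ps ps2 N i.
    by apply/(cellset_cell ps2 N g0 x0); rewrite -/(gridcell N i) gridcellN.
  move=> j ji; rewrite indicE memNset ?mule0//.
  have /andP[x0 _] := x01; have /andP[g0 _] := @gridpt01 R ps ps2 N j.
  move=> /(cellset_cell ps2 N g0 x0); rewrite -/(gridcell N j) gridcellN// => e.
  by case/eqP: ji; apply/val_inj; rewrite /= e.
Qed.

End grid_functions.

(** Functions with finitely many frequencies agree almost everywhere with
  step functions on a common fine grid. *)
Lemma finite_family_integral (p : R) (B : nat) : 1 < p -> p <= 2 ->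
  exists2 C : R, 0 < C &
  forall (ps : nat -> nat) (S : finType) (lo hi : S -> nat) (f : S -> R -> R[i]),
  (forall i, (0 < i)%N -> (2 <= ps i)%N) ->
  (forall i, (0 < i)%N -> (ps i <= B)%N) ->
  (forall s, (lo s <= hi s)%N) ->
  (forall s t n, (lo s <= n <= hi s)%N -> (lo t <= n <= hi t)%N -> s = t) ->
  (forall s, cintegrable01 (f s)) ->
  (forall s n, ~~ (lo s <= n <= hi s)%N -> vil_coef ps (f s) n = 0) ->
  (\int[mu]_(x in I01) (normc (\sum_s f s x) `^ p)%:E <=
   C%:E * \int[mu]_(x in I01) ((\sum_s normc (f s x) ^+ 2) `^ (p / 2))%:E)%E.
Proof.
move=> p1 p2; have [C C0 HC] := @grid_interval_inequality R p B p1 p2.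
exists C => // ps S lo hi f ps2 psB lohi disj fint fcoef.
pose N := (\max_s hi s)%N; pose M := vil_m ps N.
have hiM s : (hi s < M)%N.
  rewrite (leq_ltn_trans (leq_bigmax s))// -/N.
  by rewrite (leq_trans (ltn_expl N (ltnSn 1)))// vil_m_exp.
pose A s : pred nat := fun n => (lo s <= n <= hi s)%N.
pose g s (i : 'I_M) := \sum_(n < M | A s n) vil_coef ps (f s) n * @gridw R ps N n i.
have gP s i : grid_proj (A s) (g s) i = g s i.
  rewrite /grid_proj /g; apply: eq_bigr => n An.
  by rewrite (grid_coef_sum ps2 (A s) (vil_coef ps (f s)) n) An.
have fE : {ae mu, forall x, 0 <= x < 1 -> forall (i : 'I_M), cell ps N x = i ->
    forall s, f s x = g s i}.
  have H s : {ae mu, forall x, 0 <= x < 1 ->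
      f s x = \sum_(n < M) vil_coef ps (f s) n * vil_w ps n x}.
    apply: spectral_expansion => // n Mn; apply: fcoef.
    by rewrite negb_and -!ltnNge (leq_trans (hiM s) Mn) orbT.
  have Hall : {ae mu, forall x, forall s, 0 <= x < 1 ->
      f s x = \sum_(n < M) vil_coef ps (f s) n * vil_w ps n x}.
    apply: filter_forall => //; exact: (ae_filter_ringOfSetsType mu).
  apply: ae_imply Hall => x Hx x01 i ei s; rewrite (Hx s x01) /g [RHS]big_mkcond.
  apply: eq_bigr => n _; rewrite /A; case: ifPn => An; last by rewrite fcoef// mul0r.
  congr (_ * _); have /andP[x0 _] := x01; have /andP[g0 _] := @gridpt01 R ps ps2 N i.
  apply: (vil_w_cell ps2 (ltn_ord n) x0 g0).
  by rewrite ei -/(gridcell N i) gridcellN.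
have mf s := cintegrable_cmeasurable (fint s).
have m1 : measurable_fun I01 (fun x => normc (\sum_s f s x) `^ p).
  apply: (measurableT_comp (measurable_powR _)).
  by apply: cmeasurable_normc; exact: cmeasurable_sum.
have m2 : measurable_fun I01 (fun x => (\sum_s normc (f s x) ^+ 2) `^ (p / 2)).
  apply: (measurableT_comp (measurable_powR _)).
  apply: measurable_sum => s; apply: measurable_funX.
  exact: cmeasurable_normc.
rewrite (grid_integral ps2 m1 (Phi := fun i => normc (\sum_s g s i) `^ p)); first last.
- apply: ae_imply fE => x Hx x01 i ei; congr (normc _ `^ _).
  by apply: eq_bigr => s _; exact: Hx.
- by move=> i; exact: powR_ge0.
rewrite (grid_integral ps2 m2
  (Phi := fun i => (\sum_s normc (g s i) ^+ 2) `^ (p / 2))); first last.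
- apply: ae_imply fE => x Hx x01 i ei; congr (_ `^ _).
  by apply: eq_bigr => s _; rewrite (Hx x01 i ei).
- by move=> i; exact: powR_ge0.
rewrite -EFinM lee_fin mulrCA ler_wpM2l ?invr_ge0//.
apply: (HC ps N S lo hi g ps2 psB) => //.
by move=> s; rewrite lohi hiM.
Qed.

End finite_families.

(** * Completeness of Lp *)

Section Lp_completeness.
Context {R : realType}.
Local Notation mu := (@lebesgue_measure R).
Local Notation I01 := (unit_itv R).

Lemma geometric_increments_cvg (a : nat -> R) (g rho : R) : 0 <= rho < 1 ->
  (forall j, `|a j.+1 - a j| <= g * rho ^+ j) -> cvgn a.
Proof.
move=> /andP[rho0 rho1] ha.
have g0 : 0 <= g.
  by have := ha 0%N; rewrite expr0 mulr1; apply: le_trans.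
have sc : cvgn (series (telescope a)).
  apply: (@normed_cvg R R^o).
  apply: (@series_le_cvg _ _ (geometric g rho)).
  - by move=> n; exact: normr_ge0.
  - by move=> n; rewrite mulr_ge0// exprn_ge0.
  - by move=> n; exact: ha.
  - by apply: is_cvg_geometric_series; rewrite ger0_norm.
have -> : a = (fun n => a 0%N + series (telescope a) n).
  by apply/funext => n; rewrite -eq_sum_telescope.
by apply: is_cvgD => //; exact: is_cvg_cst.
Qed.

Lemma measurable_normc_powR D (p : R) (f : R -> R[i]) : cmeasurable D f ->
  measurable_fun D (fun x => (normc (f x) `^ p)%:E).
Proof.
move=> mf; apply/measurable_EFinP.
by apply: (measurableT_comp (measurable_powR _)); exact: cmeasurable_normc.
Qed.

Lemma cmeasurableB D (f g : R -> R[i]) : cmeasurable D f -> cmeasurable D g ->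
  cmeasurable D (fun x => f x - g x).
Proof.
move=> [fr fi] [gr gi]; split.
  by under eq_fun do rewrite ReB; exact: measurable_funB.
by under eq_fun do rewrite ImB; exact: measurable_funB.
Qed.

(** Completeness of [L^p]: along a subsequence with increments that are
  geometrically small in [L^p], a weighted sum of the powers of the increments
  is integrable, hence finite almost everywhere, and the increments are
  dominated there by a geometric sequence.  The limit is an upper limit, which
  is measurable without a restriction of the domain. *)
Lemma Lp_cauchy_limit (p : R) (S : nat -> R -> R[i]) (tau : nat -> \bar R) :
  0 < p -> (forall n, cmeasurable I01 (S n)) ->
  (forall k n, (k <= n)%N ->
    (\int[mu]_(x in I01) (normc (S n x - S k x) `^ p)%:E <= tau k)%E) ->
  tau k @[k --> \oo] --> 0%E ->
  exists (F : R -> R[i]) (n_ : nat -> nat),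
    [/\ cmeasurable I01 F, (forall j, (j <= n_ j)%N) &
     {ae mu, forall x, I01 x ->
       complex.Re (S (n_ j) x) @[j --> \oo] --> complex.Re (F x) /\
       complex.Im (S (n_ j) x) @[j --> \oo] --> complex.Im (F x)}].
Proof.
move=> p0 mS cauchy tau0.
(* Chosen so that [e j] remains summable after the weight [2 ^+ j] below. *)
pose e j : R := (2 ^+ j)^-1 * (1 / (2 ^ j.+1)%:R).
have e0 j : 0 < e j by rewrite mulr_gt0 ?invr_gt0 ?exprn_gt0// divr_gt0// ltr0n expn_gt0.
have small j : exists N, forall n, (N <= n)%N -> (tau n <= (e j)%:E)%E.
  have : \forall n \near \oo, (tau n < (e j)%:E)%E.
    apply: (tau0 [set t | (t < (e j)%:E)%E]).
    by apply: (@open_ereal_lt' _ 0%E); rewrite lte_fin.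
  by move=> [N _ HN]; exists N => n Nn; apply/ltW/HN.
have [N_ HN] := boolp.choice small.
pose n_ := fix n_ j := if j is j'.+1 then maxn (n_ j').+1 (N_ j) else N_ 0%N.
have n_S j : (n_ j < n_ j.+1)%N by rewrite /= leq_maxl.
have n_N j : (N_ j <= n_ j)%N by case: j => //= j; rewrite leq_maxr.
have n_j j : (j <= n_ j)%N.
  by elim: j => // j IH; exact: leq_ltn_trans IH (n_S j).
pose D j x := S (n_ j.+1) x - S (n_ j) x.
have mD j : cmeasurable I01 (D j) by exact: cmeasurableB.
pose d j x : \bar R := ((2 ^+ j)%:E * (normc (D j x) `^ p)%:E)%E.
have md j : measurable_fun I01 (d j).
  by apply: emeasurable_funM; [exact: measurable_cst|exact: measurable_normc_powR].
have d0 j x : I01 x -> (0 <= d j x)%E.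
  by move=> _; rewrite mule_ge0// lee_fin ?exprn_ge0// powR_ge0.
have intd j : (\int[mu]_(x in I01) d j x <= (1 / (2 ^ j.+1)%:R)%:E)%E.
  have -> : (\int[mu]_(x in I01) d j x = (2 ^+ j)%:E *
      \int[mu]_(x in I01) (normc (D j x) `^ p)%:E)%E.
    apply: ge0_integralZl => //.
    - exact: measurable_unit_itv.
    - exact: measurable_normc_powR.
    - by move=> x _; rewrite lee_fin powR_ge0.
  have := cauchy (n_ j) (n_ j.+1) (ltnW (n_S j)).
  move=> /le_trans/(_ (HN j _ (n_N j))) H.
  have -> : (1 / (2 ^ j.+1)%:R)%:E = ((2 ^+ j)%:E * (e j)%:E)%E :> \bar R.
    by rewrite -EFinM mulrA mulfV ?mul1r// gt_eqF// exprn_gt0.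
  by rewrite lee_pmul2l// lte_fin exprn_gt0.
pose G x := (\sum_(j <oo) d j x)%E.
have intG : (\int[mu]_(x in I01) G x < +oo)%E.
  rewrite integral_nneseries//; last exact: measurable_unit_itv.
  apply: (@le_lt_trans _ _ 1%E); last by rewrite ltry.
  apply: le_trans (epsilon_trick0 xpredT (ler01 : 0 <= 1 :> R)).
  apply: lee_nneseries => [j _ _|j _]; first by apply: integral_ge0 => x; exact: d0.
  exact: intd.
have iG : mu.-integrable I01 G.
  apply/integrableP; split.
    by apply: ge0_emeasurable_sum => [j x Ix _|j _]; [exact: d0|exact: md].
  under eq_integral.
    move=> x xI; rewrite gee0_abs; last first.
      by apply: nneseries_ge0 => j _ _; apply: d0; exact: set_mem.
    over.
  exact: intG.
pose F x : R[i] := (fine (limn_esup (fun j => (complex.Re (S (n_ j) x))%:E)) +i*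
   fine (limn_esup (fun j => (complex.Im (S (n_ j) x))%:E)))%C.
exists F, n_; split=> //.
  split => /=; apply: measurableT_comp => //; apply: measurable_fun_limn_esup.
    by move=> j; apply/measurable_EFinP; case: (mS (n_ j)).
  by move=> j; apply/measurable_EFinP; case: (mS (n_ j)).
have : {ae mu, forall x, I01 x -> G x \is a fin_num}.
  by apply: integrable_ae iG; exact: measurable_unit_itv.
apply: ae_imply => x Gfin Ix.
have {}Gfin := Gfin Ix; set g := fine (G x).
pose rho : R := 2^-1 `^ p^-1.
have rho01 : 0 <= rho < 1.
  have ip : 0 < p^-1 by rewrite invr_gt0.
  have := gt0_ltr_powR ip (_ : 2^-1 \in Num.nneg) (_ : (1 : R) \in Num.nneg).
  rewrite !nnegrE invr_ge0 => /(_ (ler0n _ _) ler01).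
  by rewrite powR1 powR_ge0 => -> //; rewrite invf_lt1// ltr1n.
have bd j : normc (D j x) <= g `^ p^-1 * rho ^+ j.
  have h : (d j x <= G x)%E.
    rewrite (_ : G x = d j x + \sum_(0 <= k <oo | k != j) d k x)%E; last first.
      by apply: (@nneseriesD1 _ (d ^~ x) j xpredT) => // k _; exact: d0.
    by rewrite leeDl// nneseries_ge0// => k _ _; exact: d0.
  have {}h : 2 ^+ j * normc (D j x) `^ p <= g.
    by rewrite -lee_fin EFinM fineK.
  have {}h : normc (D j x) `^ p <= g * (2^-1) ^+ j.
    by rewrite exprVn ler_pdivlMr ?exprn_gt0// mulrC.
  have g0 : 0 <= g by rewrite fine_ge0// nneseries_ge0// => k _ _; exact: d0.
  have pv : 0 <= p^-1 by rewrite invr_ge0 ltW.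
  have := powR_le pv (powR_ge0 _ _) h.
  rewrite -powRrM mulfV ?gt_eqF// powRr1 ?normc_ge0// => h2; apply: (le_trans h2).
  have half : 0 <= 2^-1 :> R by rewrite invr_ge0.
  by rewrite (powRM _ g0 (exprn_ge0 j half)) (powR_exprn _ _ half).
have lim (u : R[i] -> R) : (forall z w, `|u z - u w| <= normc (z - w)) ->
   u (S (n_ j) x) @[j --> \oo] -->
     fine (limn_esup (fun j => (u (S (n_ j) x))%:E)).
  move=> ub; have cv : cvgn (fun j => u (S (n_ j) x)).
    apply: (geometric_increments_cvg (g := g `^ p^-1) rho01) => j.
    by apply: le_trans (ub _ _) _; exact: bd.
  suff -> : limn_esup (fun j => (u (S (n_ j) x))%:E) =
     (limn (fun j => u (S (n_ j) x)))%:E by exact: cv.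
  have cvE : (fun j => (u (S (n_ j) x))%:E) @ \oo -->
      (limn (fun j => u (S (n_ j) x)))%:E.
    by apply/fine_cvgP; split; [exact: nearW|exact: cv].
  rewrite is_cvg_limn_esupE; last by apply/cvg_ex; eexists; exact: cvE.
  by apply/cvg_lim.
split.
  by apply: lim => z w; rewrite -ReB abs_Re_le_normc.
by apply: lim => z w; rewrite -ImB abs_Im_le_normc.
Qed.

Lemma powR_cvg (p : R) (u : nat -> R) (l : R) : 0 < p -> 0 <= l ->
  (forall n, 0 <= u n) ->
  u n @[n --> \oo] --> l -> u n `^ p @[n --> \oo] --> l `^ p.
Proof.
move=> p0; rewrite le_eqVlt => /predU1P[<-|l0] u0 ul.
  rewrite powR0 ?gt_eqF//; apply/cvgr0Pnorm_le => e e0.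
  have ep : 0 < e `^ p^-1 by exact: powR_gt0.
  near=> n; have : `|u n| <= e `^ p^-1 by near: n; exact: cvgr0_norm_le.
  rewrite !ger0_norm ?powR_ge0// => un.
  have := powR_le (ltW p0) (u0 n) un.
  rewrite -powRrM mulVf ?gt_eqF// powRr1 ?(ltW e0)//.
have c : {for l, continuous (fun a : R => a `^ p)}.
  apply: differentiable_continuous; apply/derivable1_diffP.
  by apply: derivable_powR; rewrite in_itv /= l0.
by apply: (@cvg_comp _ _ _ u (fun a => a `^ p) _ _ _ ul); exact: c.
Unshelve. all: by end_near. Qed.

Lemma normc_powR_cvg (p : R) (z : nat -> R[i]) (w : R[i]) : 0 < p ->
  complex.Re (z n) @[n --> \oo] --> complex.Re w ->
  complex.Im (z n) @[n --> \oo] --> complex.Im w ->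
  normc (z n) `^ p @[n --> \oo] --> normc w `^ p.
Proof.
move=> p0 zr zi.
have E y : normc y `^ p = (complex.Re y ^+ 2 + complex.Im y ^+ 2) `^ (p / 2).
  by rewrite -normc_sq powR_sq// normc_ge0.
rewrite E; under eq_fun do rewrite E.
apply: powR_cvg; first by rewrite divr_gt0.
- by rewrite addr_ge0// sqr_ge0.
- by move=> n; rewrite addr_ge0// sqr_ge0.
- by apply: cvgD; rewrite expr2; under eq_fun do rewrite expr2; exact: cvgM.
Qed.

Lemma limn_einf_le (u : nat -> \bar R) (c : \bar R) :
  (forall n, (u n <= c)%E) -> (limn_einf u <= c)%E.
Proof.
move=> uc; rewrite limn_einf_lim; apply: lime_le; first exact: is_cvg_einfs.
by apply: nearW => n; apply: le_trans (uc n); apply: ereal_inf_lbound; exists n => /=.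
Qed.

Lemma limn_einf_ge (u : nat -> \bar R) (c : \bar R) :
  (forall n, (c <= u n)%E) -> (c <= limn_einf u)%E.
Proof.
move=> uc; rewrite limn_einf_lim; apply: lime_ge; first exact: is_cvg_einfs.
by apply: nearW => n; apply: le_ereal_inf_tmp => _ [k _ <-].
Qed.

Lemma Lp_fatou (p : R) (S : nat -> R -> R[i]) (F g : R -> R[i]) (c : \bar R) K :
  0 < p -> (forall n, cmeasurable I01 (S n)) ->
  cmeasurable I01 F -> cmeasurable I01 g ->
  {ae mu, forall x, I01 x ->
       complex.Re (S n x) @[n --> \oo] --> complex.Re (F x) /\
       complex.Im (S n x) @[n --> \oo] --> complex.Im (F x)} ->
  (forall n, (K <= n)%N ->
    (\int[mu]_(x in I01) (normc (S n x - g x) `^ p)%:E <= c)%E) ->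
  (\int[mu]_(x in I01) (normc (F x - g x) `^ p)%:E <= c)%E.
Proof.
move=> p0 mS mF mg cv bd.
pose h n x : \bar R := (normc (S (n + K)%N x - g x) `^ p)%:E.
have mh n : measurable_fun I01 (h n).
  by apply: measurable_normc_powR; exact: cmeasurableB.
have h0 n x : I01 x -> (0 <= h n x)%E by move=> _; rewrite lee_fin powR_ge0.
apply: (@le_trans _ _ (\int[mu]_(x in I01) limn_einf (h ^~ x))%E).
  apply: ae_ge0_le_integral.
  - exact: measurable_unit_itv.
  - by move=> x _; rewrite lee_fin powR_ge0.
  - by apply: measurable_normc_powR; exact: cmeasurableB.
  - by move=> x Ix; apply: limn_einf_ge => n; exact: h0.
  - rewrite /limn_einf; apply: measurableT_comp => //.
    apply: (@measurable_fun_limn_esup _ _ _ _ (fun n x => - h n x)%E) => n.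
    by apply: measurableT_comp => //; exact: mh.
  - apply: ae_imply cv => x + Ix => /(_ Ix)[cr ci].
    have -> : limn_einf (h ^~ x) = (normc (F x - g x) `^ p)%:E.
      have : h ^~ x @ \oo --> (normc (F x - g x) `^ p)%:E.
        apply/fine_cvgP; split; first exact: nearW.
        rewrite /h /=; apply: (@normc_powR_cvg p (fun n => S (n + K)%N x - g x)) => //.
          under eq_fun do rewrite ReB; rewrite ReB.
          apply: cvgB; last exact: cvg_cst.
          by rewrite (@cvg_shiftn K _ (fun n => complex.Re (S n x))).
        under eq_fun do rewrite ImB; rewrite ImB.
        apply: cvgB; last exact: cvg_cst.
        by rewrite (@cvg_shiftn K _ (fun n => complex.Im (S n x))).
      by move/cvg_limn_einf_sup => [].
    exact: lexx.
apply: le_trans (fatou mu _ mh h0) _; first exact: measurable_unit_itv.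
by apply: limn_einf_le => n; apply: bd; rewrite leq_addl.
Qed.

End Lp_completeness.

(** * Arbitrary families *)

Section Lp_norms.
Context {R : realType}.
Local Notation mu := (@lebesgue_measure R).
Local Notation I01 := (unit_itv R).

Lemma Lp01E (p : R) (phi : R -> \bar R) : 0 < p ->
  Lp01 p phi = ((\int[mu]_(x in I01) (`|phi x| `^ p)) `^ p^-1)%E.
Proof.
move=> p0; rewrite /Lp01 unlock [in RHS]integral_mkcond.
congr (_ `^ _)%E; apply: eq_integral => x _; rewrite !patchE.
by case: ifPn => // _; rewrite abse0 poweR0r// gt_eqF.
Qed.

Lemma cLp01E (p : R) (f : R -> R[i]) : 0 < p ->
  cLp01 p f = ((\int[mu]_(x in I01) (normc (f x) `^ p)%:E) `^ p^-1)%E.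
Proof.
move=> p0; rewrite /cLp01 (Lp01E _ p0); congr (_ `^ _)%E; apply: eq_integral => x _.
by rewrite gee0_abs ?lee_fin ?normc_ge0// poweR_EFin.
Qed.

Lemma Lp01_square_fun (S : choiceType) (p : R) (f : S -> R -> R[i]) : 0 < p ->
  Lp01 p (square_fun f) = ((\int[mu]_(x in I01)
    ((\esum_(s in [set: S]) (normc (f s x) ^+ 2)%:E) `^ (p / 2))) `^ p^-1)%E.
Proof.
move=> p0; rewrite Lp01E//; congr (_ `^ _)%E; apply: eq_integral => x _.
by rewrite gee0_abs ?poweR_ge0// /square_fun -poweRrM mulrC.
Qed.

Lemma le_poweR (r : R) (x y : \bar R) : 0 <= r -> (0 <= x)%E -> (x <= y)%E ->
  (x `^ r <= y `^ r)%E.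
Proof.
move=> r0 x0 xy; apply: gt0_ler_poweR => //; rewrite in_itv/= leey andbT//.
exact: le_trans xy.
Qed.

End Lp_norms.

Section interval_families.
Context {R : realType}.
Local Notation mu := (@lebesgue_measure R).
Local Notation I01 := (unit_itv R).
Variables (p C : R) (S : choiceType) (lo : S -> nat) (f : S -> R -> R[i]).
Hypothesis p0 : 0 < p.
Hypothesis C0 : 0 < C.
Hypothesis lo_inj : injective lo.
Hypothesis mf : forall s, cmeasurable I01 (f s).
Hypothesis finite_bound : forall A : {fset S},
  (\int[mu]_(x in I01) (normc (\sum_(s <- A) f s x) `^ p)%:E <=
   C%:E * \int[mu]_(x in I01) ((\sum_(s <- A) normc (f s x) ^+ 2) `^ (p / 2))%:E)%E.

Let q (A : {fset S}) x := \sum_(s <- A) normc (f s x) ^+ 2.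
Let Q x : \bar R := (\esum_(s in [set: S]) (normc (f s x) ^+ 2)%:E)%E.

Lemma low_finite n : finite_set [set s | (lo s < n)%N].
Proof.
have -> : [set s | (lo s < n)%N] = lo @^-1` `I_n by [].
apply: finite_preimage; last exact: finite_II.
by move=> s t _ _; exact: lo_inj.
Qed.

(** The finite subfamilies that exhaust the family. *)
Definition low n : {fset S} := fset_set [set s | (lo s < n)%N].

Lemma in_low n s : (s \in low n) = (lo s < n)%N.
Proof.
rewrite in_fset_set; last exact: low_finite.
by apply/idP/idP => [/set_mem//|?]; apply/mem_set.
Qed.

Lemma low0 : low 0 = fset0.
Proof. by apply/fsetP => s; rewrite in_low inE. Qed.

Lemma low_sub k n : (k <= n)%N -> (low k `<=` low n)%fset.
Proof.
by move=> kn; apply/fsubsetP => s; rewrite !in_low => /leq_trans; apply.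
Qed.

Lemma low_exhausts (B : {fset S}) : exists n, (B `<=` low n)%fset.
Proof.
exists (\max_(s <- B) lo s).+1; apply/fsubsetP => s sB; rewrite in_low ltnS.
by rewrite (big_rem s)//= leq_maxl.
Qed.

Lemma fset_sum_split (V : nmodType) (B D : {fset S}) (F : S -> V) :
  (D `<=` B)%fset ->
  \sum_(s <- B) F s = \sum_(s <- D) F s + \sum_(s <- (B `\` D)%fset) F s.
Proof.
move=> DB; rewrite -big_cat; apply: perm_big; apply: uniq_perm.
- exact: fset_uniq.
- rewrite cat_uniq !fset_uniq /= andbT; apply/hasPn => s.
  by rewrite inE => /andP[].
- move=> s; rewrite mem_cat inE; have [sD|] := boolP (s \in D) => //=.
  by rewrite (fsubsetP DB).
Qed.

Lemma q_ge0 A x : 0 <= q A x.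
Proof. by apply: sumr_ge0 => s _; exact: sqr_ge0. Qed.

Lemma q_le_Q A x : ((q A x)%:E <= Q x)%E.
Proof.
apply: esum_ge; exists [set` A]; first by split => //; exact: finite_fset.
by rewrite fsbig_finite//= set_fsetK sumEFin.
Qed.

Lemma Q_ge0 x : (0 <= Q x)%E.
Proof. by apply: esum_ge0 => s _; rewrite lee_fin sqr_ge0. Qed.

Lemma q_mono (A B : {fset S}) x : (A `<=` B)%fset -> q A x <= q B x.
Proof.
by move=> AB; rewrite /q (fset_sum_split _ AB) lerDl; exact: q_ge0.
Qed.

Lemma q_cvg x : (q (low n) x)%:E @[n --> \oo] --> Q x.
Proof.
have -> : Q x = ereal_sup (range (fun n => (q (low n) x)%:E)).
  apply/eqP; rewrite eq_le; apply/andP; split.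
    apply: ge_ereal_sup => _ [X [finX _] <-].
    have [n Xn] := low_exhausts (fset_set X).
    apply: (@le_trans _ _ (q (low n) x)%:E); last by apply: ereal_sup_ubound; exists n.
    by rewrite fsbig_finite//= sumEFin lee_fin; exact: q_mono.
  by apply: ge_ereal_sup => _ [n _ <-]; exact: q_le_Q.
apply: ereal_nondecreasing_cvgn => k n kn.
by rewrite lee_fin; apply: q_mono; exact: low_sub.
Qed.

Lemma measurable_q A : measurable_fun I01 (fun x => (q A x)%:E).
Proof.
apply/measurable_EFinP; apply: measurable_sum => s; apply: measurable_funX.
exact: cmeasurable_normc.
Qed.

Lemma measurable_Q : measurable_fun I01 Q.
Proof.
apply: (emeasurable_fun_cvg (fun n x => (q (low n) x)%:E)).
  by move=> n; exact: measurable_q.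
by move=> x _; exact: q_cvg.
Qed.

Let tail k x : \bar R := ((Q x - (q (low k) x)%:E) `^ (p / 2))%E.
Let tau k : \bar R := (C%:E * \int[mu]_(x in I01) tail k x)%E.

Let measurable_tail k : measurable_fun I01 (tail k).
Proof.
apply: (measurableT_comp (measurable_poweR _)).
by apply: emeasurable_funB; [exact: measurable_Q|exact: measurable_q].
Qed.

Let p20 : 0 < p / 2. Proof. by rewrite divr_gt0. Qed.

(** The finite inequality applied to the members of [B] outside [D], whose
  squares are part of the tail of the square function. *)
Lemma tail_bound k (B D : {fset S}) : (low k `<=` D)%fset -> (D `<=` B)%fset ->
  (\int[mu]_(x in I01)
     (normc (\sum_(s <- B) f s x - \sum_(s <- D) f s x) `^ p)%:E <= tau k)%E.
Proof.
move=> kD DB.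
under eq_integral => x _ do rewrite (fset_sum_split _ DB) addrC addrA addNr add0r.
apply: (le_trans (finite_bound _)); rewrite lee_wpmul2l ?lee_fin ?(ltW C0)//.
apply: ge0_le_integral => //.
- exact: measurable_unit_itv.
- by move=> x _; rewrite lee_fin powR_ge0.
- apply/measurable_EFinP; apply: (measurableT_comp (measurable_powR _)).
  by apply/measurable_EFinP; exact: measurable_q.
- exact: measurable_tail.
- move=> x _; rewrite -poweR_EFin /tail; apply: le_poweR.
  + exact: ltW.
  + by rewrite lee_fin; exact: q_ge0.
  rewrite leeBrDr//; apply: le_trans (q_le_Q B x).
  rewrite -EFinD lee_fin {2}/q (fset_sum_split _ DB) addrC lerD2r.
  exact: q_mono.
Qed.

Hypothesis Q_integrable : (\int[mu]_(x in I01) (Q x `^ (p / 2)) < +oo)%E.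

Lemma tail_cvg : tau k @[k --> \oo] --> 0%E.
Proof.
have mQp : measurable_fun I01 (fun x => Q x `^ (p / 2))%E.
  by apply: (measurableT_comp (measurable_poweR _)); exact: measurable_Q.
have iQ : mu.-integrable I01 (fun x => Q x `^ (p / 2))%E.
  apply/integrableP; split => //.
  by under eq_integral => x _ do rewrite gee0_abs ?poweR_ge0//.
have finQ : {ae mu, forall x, I01 x -> Q x `^ (p / 2) \is a fin_num}%E.
  by apply: integrable_ae iQ; exact: measurable_unit_itv.
have cv : {ae mu, forall x, I01 x -> tail k x @[k --> \oo] --> (cst 0%E) x}.
  apply: ae_imply finQ => x fx Ix.
  have Qfin : Q x \is a fin_num.
    have := fx Ix; rewrite !ge0_fin_numE ?Q_ge0 ?poweR_ge0//.
    by apply: lty_poweRy; rewrite gt_eqF.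
  have E k : tail k x = ((fine (Q x) - q (low k) x) `^ (p / 2))%:E.
    by rewrite /tail -poweR_EFin EFinB fineK.
  under eq_fun do rewrite E.
  apply/fine_cvgP; split; first exact: nearW.
  rewrite -[X in _ --> X](@powR0 R (p / 2)) ?gt_eqF//.
  apply: powR_cvg => //.
    by move=> n; rewrite subr_ge0 -lee_fin fineK// q_le_Q.
  rewrite -(subrr (fine (Q x))); apply: cvgB; first exact: cvg_cst.
  by have := @q_cvg x; rewrite -(fineK Qfin) => /fine_cvgP[_].
have dom : {ae mu, forall x k, I01 x -> (`|tail k x| <= Q x `^ (p / 2))%E}.
  apply: aeW => x k _; rewrite gee0_abs ?poweR_ge0//; apply: le_poweR.
  + exact: ltW.
  + by rewrite sube_ge0 ?q_le_Q.
  + by rewrite leeBlDr// leeDl// lee_fin q_ge0.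
have [_ _ lim] := @dominated_convergence _ _ R mu I01 measurable_unit_itv
  tail (cst 0%E) _ measurable_tail (measurable_cst _) cv iQ dom.
rewrite -(mule0 C%:E); apply: cvgeZl => //.
by rewrite integral0 in lim.
Qed.

(** The rate gives the limit along all finite subsets and, for [k = 0], where
  the tail is the whole square function, the norm inequality. *)
Lemma family_sum : exists2 F : R -> R[i], cmeasurable I01 F &
  forall k (D : {fset S}), (low k `<=` D)%fset ->
  (\int[mu]_(x in I01) (normc (F x - \sum_(s <- D) f s x) `^ p)%:E <= tau k)%E.
Proof.
have mS (D : {fset S}) : cmeasurable I01 (fun x => \sum_(s <- D) f s x).
  exact: cmeasurable_sum.
have [F [n_ [mF nj cv]]] := @Lp_cauchy_limit R p
  (fun n x => \sum_(s <- low n) f s x) tau p0 (fun n => mS (low n))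
  (fun k n kn => tail_bound (fsubset_refl _) (low_sub kn)) tail_cvg.
exists F => // k D kD; have [K DK] := low_exhausts D.
apply: (@Lp_fatou R p (fun j x => \sum_(s <- low (n_ j)) f s x) F _ _ K) => //.
move=> j Kj; apply: tail_bound => //.
by apply: fsubset_trans DK _; apply: low_sub; exact: leq_trans (nj j).
Qed.

Lemma tau0E : tau 0 = (C%:E * \int[mu]_(x in I01) (Q x `^ (p / 2)))%E.
Proof.
congr (_ * _)%E; apply: eq_integral => x _.
by rewrite /tail low0 /q big_seq_fset0 sube0.
Qed.

Lemma interval_family_sum : exists2 F : R -> R[i], Lp_sum p f F &
  (cLp01 p F <= (C `^ p^-1)%:E * Lp01 p (square_fun f))%E.
Proof.
have ip : 0 <= p^-1 by rewrite invr_ge0 ltW.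
have [F mF HF] := family_sum.
have I0 (g : R -> R[i]) : (0 <= \int[mu]_(x in I01) (normc (g x) `^ p)%:E)%E.
  by apply: integral_ge0 => x _; rewrite lee_fin powR_ge0.
have J0 : (0 <= \int[mu]_(x in I01) (Q x `^ (p / 2)))%E.
  by apply: integral_ge0 => x _; exact: poweR_ge0.
have FE : (cLp01 p F <= (C `^ p^-1)%:E * Lp01 p (square_fun f))%E.
  rewrite cLp01E// Lp01_square_fun// -poweR_EFin -poweRM//; last first.
    by rewrite lee_fin ltW.
  rewrite -/Q -tau0E; apply: le_poweR => //.
  have := HF 0%N fset0; rewrite low0 fsubset_refl => /(_ isT).
  by under eq_integral => x _ do rewrite big_seq_fset0 subr0.
exists F => //; split=> //.
  apply: le_lt_trans FE _; rewrite Lp01_square_fun//.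
  by rewrite lte_mul_pinfty ?lee_fin ?powR_ge0// poweR_lty.
move=> U /= [e /= e0 eU].
have d0 : 0 < (e / 2) `^ p by rewrite powR_gt0// divr_gt0.
have : \forall k \near \oo, (tau k < ((e / 2) `^ p)%:E)%E.
  apply: (@tail_cvg [set t | (t < ((e / 2) `^ p)%:E)%E]).
  by apply: (@open_ereal_lt' _ 0%E); rewrite lte_fin.
move=> [k _ /(_ k (leqnn k)) tk].
exists (low k) => // D /= kD.
have le2 : (cLp01 p (fun x => (F x - \sum_(s <- D) f s x)%R) <= (e / 2)%:E)%E.
  have -> : (e / 2)%:E = (((e / 2) `^ p)%:E `^ p^-1)%E.
    by rewrite poweR_EFin -powRrM mulfV ?gt_eqF// powRr1// divr_ge0// ltW.
  rewrite cLp01E//; apply: le_poweR => //.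
  exact: le_trans (HF k D kD) (ltW tk).
have ge0 : (0 <= cLp01 p (fun x => (F x - \sum_(s <- D) f s x)%R))%E.
  exact: Lnorm_ge0.
move: ge0 le2; case: (cLp01 _ _) => [r| |]//; rewrite !lee_fin => r0 re.
apply: eU; rewrite /ball /= sub0r normrN ger0_norm//.
by rewrite (le_lt_trans re)// ltr_pdivrMr// mulr_natr mulr2n ltrDl.
Qed.

End interval_families.

Lemma segment_bounds (J : set nat) : is_segment J ->
  exists ab : nat * nat, (ab.1 <= ab.2)%N /\
    forall n, J n <-> (ab.1 <= n <= ab.2)%N.
Proof.
move=> [a [b [ab ->]]]; exists (a, b.-1) => /=.
have b0 : (0 < b)%N by exact: leq_ltn_trans ab.
split; first by rewrite -ltnS prednK.
by move=> n; rewrite /= -[(n <= b.-1)%N]ltnS prednK.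
Qed.

Theorem theorem1 (R : realType) (ps : nat -> nat)
    (ps_ge2 : forall i, (1 <= i)%N -> (2 <= ps i)%N)
    (ps_bounded : exists B : nat, forall i, (1 <= i)%N -> (ps i <= B)%N)
    (p : R) (p_gt1 : 1 < p) (p_le2 : p <= 2) :
  exists2 C : R, 0 < C &
  forall (S : choiceType) (I : S -> set nat) (f : S -> R -> R[i]),
    (forall s, is_segment (I s)) ->
    trivIset [set: S] I ->
    (forall s, cintegrable01 (f s)) ->
    (forall s, [set n | vil_coef ps (f s) n != 0] `<=` I s) ->
    (finite_set [set: S] ->
       (cLp01 p (fun x => (\sum_(s \in [set: S]) f s x)%R)
          <= C%:E * Lp01 p (square_fun f))%E) /\
    ((Lp01 p (square_fun f) < +oo)%E ->
       exists2 F : R -> R[i], Lp_sum p f F &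
         (cLp01 p F <= C%:E * Lp01 p (square_fun f))%E).
Proof.
have [B psB] := ps_bounded.
have [C C0 HC] := @finite_family_integral R p B p_gt1 p_le2.
have p0 : 0 < p by lra.
exists (C `^ p^-1); first exact: powR_gt0.
move=> S I f segI trivI fint fspec.
have [ends endsP] := boolp.choice (fun s => segment_bounds (segI s)).
pose lo s := (ends s).1; pose hi s := (ends s).2.
have lohi s : (lo s <= hi s)%N by have [] := endsP s.
have IE s n : I s n <-> (lo s <= n <= hi s)%N by have [_] := endsP s.
have disj s t n : (lo s <= n <= hi s)%N -> (lo t <= n <= hi t)%N -> s = t.
  by move=> /IE sn /IE tn; apply: trivI => //; exists n.
have lo_inj : injective lo.
  move=> s t e; apply: (disj s t (lo s)); first by rewrite leqnn lohi.
  by rewrite e leqnn lohi.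
have fcoef s n : ~~ (lo s <= n <= hi s)%N -> vil_coef ps (f s) n = 0.
  by move=> nI; apply/eqP; apply: contraNT nI => /(fspec s) /IE.
have fin (A : {fset S}) :
    (\int[lebesgue_measure]_(x in unit_itv R)
       (normc (\sum_(s <- A) f s x) `^ p)%:E <=
     C%:E * \int[lebesgue_measure]_(x in unit_itv R)
       ((\sum_(s <- A) normc (f s x) ^+ 2) `^ (p / 2))%:E)%E.
  under eq_integral => x _ do rewrite big_seq_fsetE.
  under [in leRHS]eq_integral => x _ do rewrite big_seq_fsetE.
  apply: (HC ps _ (fun s : A => lo (val s)) (fun s : A => hi (val s))
    (fun s : A => f (val s))) => //.
    by move=> s t n sn tn; apply: val_inj; exact: disj sn tn.
  by move=> s n; exact: fcoef.
split=> [finS|sq_fin]; last first.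
  apply: (@interval_family_sum R p C S lo f p0 C0 lo_inj) => //.
    by move=> s; exact: cintegrable_cmeasurable.
  move: sq_fin; rewrite Lp01_square_fun//; apply: lty_poweRy.
  by rewrite gt_eqF// invr_gt0.
rewrite cLp01E// Lp01_square_fun// -poweR_EFin -poweRM//; first last.
- by apply: integral_ge0 => x _; exact: poweR_ge0.
- by rewrite lee_fin ltW.
apply: le_poweR; first by rewrite invr_ge0 ltW.
  by apply: integral_ge0 => x _; rewrite lee_fin powR_ge0.
under eq_integral => x _ do rewrite fsbig_finite//=.
apply: (le_trans (fin _)); rewrite lee_wpmul2l ?lee_fin ?(ltW C0)//.
rewrite le_eqVlt; apply/orP; left; apply/eqP; apply: eq_integral => x _.
rewrite -poweR_EFin; congr (_ `^ _)%E.
rewrite esum_fset//; last by move=> s _; rewrite lee_fin sqr_ge0.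
by rewrite fsbig_finite//= sumEFin.
Qed.
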